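(* Let $(p: A\to M,[\cdot,\cdot],\rho)$ be a Lie algebroid and let $L\in C^\infty(A)$ be a regular Lagrangian with associated energy function $E_L$. Then there exists a (nonempty) family of Poisson brackets $\{\cdot,\cdot\}$ on the manifold $A$ such that, for each bracket of the family and for every function $f\in C^\infty(M)$, the Hamiltonian vector field (with respect to $\{\cdot,\cdot\}$) of the function $E_L+p^*f\in C^\infty(A)$ is a semispray on $A$.
   Context: A Lie algebroid $(p:A\to M,[\cdot,\cdot],\rho)$ is a smooth vector bundle with an $\mathbb{R}$-Lie bracket on $\Gamma(A)$ and a vector bundle map $\rho:A\to TM$ (anchor) with $[\sigma,f\eta]=f[\sigma,\eta]+(\mathcal{L}_{\rho(\sigma)}f)\eta$. A vector field $\mathcal{V}\in\mathfrak{X}(A)$ on the total space $A$ is a semispray if $Tp\circ\mathcal{V}=\rho$ as maps $A\to TM$, where $Tp:TA\to TM$ is the tangent map of $p$. For $L\in C^\infty(A)$, the Legendre transform $\mathscr{L}:A\to A^*$ is defined by $\langle\mathscr{L}(a),b\rangle=\frac{d}{dt}\big|_{t=0}L(a+tb)$ for $p(a)=p(b)$; $L$ is called regular if $\mathscr{L}$ is a diffeomorphism. The energy function is $E_L:=\mathcal{L}_{\mathbf{E}}L-L$, where $\mathbf{E}\in\mathfrak{X}(A)$ is the Euler (Liouville) vector field of the vector bundle $A$ (locally $\mathbf{E}=y^k\partial/\partial y^k$ in linear fiber coordinates $y^k$). A Poisson bracket on a manifold $N$ is an $\mathbb{R}$-bilinear operation on $C^\infty(N)$ making it a Lie algebra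 and satisfying $\{f,gh\}=\{f,g\}h+g\{f,h\}$; the Hamiltonian vector field $X_G$ of $G\in C^\infty(N)$ is given by $\mathcal{L}_{X_G}F=\{G,F\}$ for all $F\in C^\infty(N)$. *)

(* Defs.v *)
From HB Require Import structures.
From mathcomp Require Import all_boot all_order all_algebra.
From mathcomp Require Import all_classical all_reals all_analysis.
Set Implicit Arguments. Unset Strict Implicit. Unset Printing Implicit Defensive.
Import Order.TTheory GRing.Theory Num.Theory numFieldNormedType.Exports.
Local Open Scope classical_set_scope.
Local Open Scope ring_scope.

(* For finite-dimensional V and open U, differentiability together with C^k
   directional derivatives in every direction is the usual C^(k+1). *)
Fixpoint Ck_on (R : realType) (V W : normedModType R) (k : nat) (U : set V)
    (f : V -> W) : Prop :=
  match k with
  | 0 => forall x, U x -> {for x, continuous f}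
  | j.+1 => (forall x, U x -> differentiable f x) /\
            (forall v, Ck_on j U (fun x => 'D_v f x))
  end.

Definition smooth_on (R : realType) (V W : normedModType R) (U : set V)
  (f : V -> W) : Prop := forall k, Ck_on k U f.

(* [cpoint] is only meaningful on [ccoord @` cdom], where it inverts [ccoord]. *)
Record chart (R : realType) (n : nat) (X : Type) := Chart {
  cdom : set X;
  ccoord : X -> 'rV[R]_n;
  cpoint : 'rV[R]_n -> X }.

Definition smooth_within (R : realType) (n : nat) (X : Type)
    (AX : set (chart R n X)) (W : normedModType R) (U : set X) (f : X -> W) :=
  forall c, AX c -> smooth_on (ccoord c @` (cdom c `&` U)) (f \o cpoint c).

Definition smooth_fun (R : realType) (n : nat) (X : Type)
    (AX : set (chart R n X)) (f : X -> R) : Prop :=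
  smooth_within AX setT f.

(* Openness of the domains of the local representatives is continuity of F:
   AX and AY need not be maximal atlases, so charts of AX cannot be shrunk. *)
Definition smooth_map (R : realType) (n m : nat) (X Y : Type)
    (AX : set (chart R n X)) (AY : set (chart R m Y)) (F : X -> Y) : Prop :=
  forall c d, AX c -> AY d ->
    open (ccoord c @` (cdom c `&` F @^-1` cdom d)) /\
    smooth_on (ccoord c @` (cdom c `&` F @^-1` cdom d))
              (ccoord d \o F \o cpoint c).

Definition diffeomorphism (R : realType) (n m : nat) (X Y : Type)
    (AX : set (chart R n X)) (AY : set (chart R m Y)) (F : X -> Y) : Prop :=
  smooth_map AX AY F /\
  exists G : Y -> X, [/\ cancel F G, cancel G F & smooth_map AY AX G].

Record smoothManifold (R : realType) (n : nat) := SmoothManifold {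
  carrier :> topologicalType;
  atlas : set (chart R n carrier);
  mfd_hausdorff : hausdorff_space carrier;
  mfd_second_countable : @second_countable carrier;
  atlas_cover : forall x, exists2 c, atlas c & cdom c x;
  chart_open : forall c, atlas c -> open (cdom c);
  chart_open_image : forall c, atlas c -> open (ccoord c @` cdom c);
  chart_cancel : forall c, atlas c ->
    forall x, cdom c x -> cpoint c (ccoord c x) = x;
  chart_continuous : forall c, atlas c ->
    forall x, cdom c x -> {for x, continuous (ccoord c)};
  chart_inv_continuous : forall c, atlas c ->
    forall u, (ccoord c @` cdom c) u -> {for u, continuous (cpoint c)};
  chart_transition : forall c d, atlas c -> atlas d ->
    smooth_on (ccoord c @` (cdom c `&` cdom d)) (ccoord d \o cpoint c) }.

Arguments atlas {R n} s _.

(* Tangent vectors at x are derivations at x of the algebra of smooth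
   functions; they are represented by operators on all functions, of which
   only the values on smooth functions matter. *)
Record tangent_vector (R : realType) (n : nat) (X : Type)
    (AX : set (chart R n X)) (x : X) (v : (X -> R) -> R) : Prop := {
  tangent_linear : forall k f g, smooth_fun AX f -> smooth_fun AX g ->
    v (fun y => k * f y + g y) = k * v f + v g;
  tangent_leibniz : forall f g, smooth_fun AX f -> smooth_fun AX g ->
    v (fun y => f y * g y) = v f * g x + f x * v g }.

(* w^i d/dx^i at x, in the coordinates of the chart c *)
Definition coord_vector (R : realType) (n : nat) (X : Type) (c : chart R n X)
    (x : X) (w : 'rV[R]_n) : (X -> R) -> R :=
  fun f => 'D_w (f \o cpoint c) (ccoord c x).

Definition tangent_map (R : realType) (X Y : Type) (F : X -> Y)
    (v : (X -> R) -> R) : (Y -> R) -> R := fun f => v (f \o F).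

Record vector_field (R : realType) (n : nat) (X : Type)
    (AX : set (chart R n X)) (V : (X -> R) -> (X -> R)) : Prop := {
  vfield_smooth : forall f, smooth_fun AX f -> smooth_fun AX (V f);
  vfield_tangent : forall x, tangent_vector AX x (fun f => V f x) }.

Record poisson_bracket (R : realType) (n : nat) (X : Type)
    (AX : set (chart R n X)) (br : (X -> R) -> (X -> R) -> (X -> R)) : Prop := {
  poisson_smooth : forall f g, smooth_fun AX f -> smooth_fun AX g ->
    smooth_fun AX (br f g);
  poisson_linear_l : forall k f g h,
    smooth_fun AX f -> smooth_fun AX g -> smooth_fun AX h ->
    forall x, br (fun y => k * f y + g y) h x = k * br f h x + br g h x;
  poisson_linear_r : forall k f g h,
    smooth_fun AX f -> smooth_fun AX g -> smooth_fun AX h ->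
    forall x, br f (fun y => k * g y + h y) x = k * br f g x + br f h x;
  poisson_alternating : forall f, smooth_fun AX f -> forall x, br f f x = 0;
  poisson_jacobi : forall f g h,
    smooth_fun AX f -> smooth_fun AX g -> smooth_fun AX h ->
    forall x, br f (br g h) x + br g (br h f) x + br h (br f g) x = 0;
  poisson_leibniz : forall f g h,
    smooth_fun AX f -> smooth_fun AX g -> smooth_fun AX h ->
    forall x, br f (fun y => g y * h y) x = br f g x * h x + g x * br f h x }.

Definition hamiltonian_field (R : realType) (X : Type)
    (br : (X -> R) -> (X -> R) -> (X -> R)) (G : X -> R) :
    (X -> R) -> (X -> R) := fun F => br G F.

(* Over points outside [tdom], [tiso] is junk. *)
Record trivialization (R : realType) (r : nat) (X : Type)
    (E : X -> vectType R) := Trivialization {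
  tdom : set X;
  tiso : forall x, 'Hom(E x, 'rV[R]_r) }.

Record vectorBundle (R : realType) (n : nat) (M : smoothManifold R n)
    (r : nat) := VectorBundle {
  fiber : M -> vectType R;
  trivs : set (trivialization r fiber);
  trivs_cover : forall x, exists2 t, trivs t & tdom t x;
  triv_open : forall t, trivs t -> open (tdom t);
  triv_bijective : forall t, trivs t -> forall x, tdom t x ->
    bijective (tiso t x);
  triv_transition : forall t s, trivs t -> trivs s -> forall w : 'rV[R]_r,
    smooth_within (atlas M) (tdom t `&` tdom s)
      (fun x => tiso s x ((tiso t x)^-1%VF w)) }.

Arguments fiber {R n M r} v _.
Arguments trivs {R n M r} v _.

Definition total_space (R : realType) (X : Type) (E : X -> vectType R) : Type :=
  {x : X & E x}.

Definition bundle_proj (R : realType) (X : Type) (E : X -> vectType R) :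
  total_space E -> X := @projT1 X (fun x => E x).

(* The chart (x^i, y^k) of the total space induced by a chart of the base and
   a trivialization. *)
Definition total_chart (R : realType) (n r : nat) (X : Type)
    (E : X -> vectType R) (c : chart R n X) (t : trivialization r E) :
    chart R (n + r) (total_space E) :=
  Chart
    [set a : total_space E | cdom c (bundle_proj a) /\ tdom t (bundle_proj a)]
    (fun a : total_space E =>
       row_mx (ccoord c (bundle_proj a)) (tiso t (bundle_proj a) (projT2 a)))
    (fun u => existT (fun x => E x) (cpoint c (lsubmx u))
                ((tiso t (cpoint c (lsubmx u)))^-1%VF (rsubmx u))).

Definition total_atlas (R : realType) (n r : nat) (X : Type)
    (E : X -> vectType R) (AX : set (chart R n X))
    (T : set (trivialization r E)) : set (chart R (n + r) (total_space E)) :=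
  [set total_chart ct.1 ct.2 | ct in AX `*` T].

Definition dual_fiber (R : realType) (X : Type) (E : X -> vectType R) :
  X -> vectType R := fun x => 'Hom(E x, R^o).

(* alpha |-> (alpha e_i)_i where (e_i)_i is the local frame defined by t *)
Definition dual_triv (R : realType) (r : nat) (X : Type) (E : X -> vectType R)
    (t : trivialization r E) : trivialization r (dual_fiber E) :=
  Trivialization (tdom t)
    (fun x => linfun (fun alpha : 'Hom(E x, R^o) =>
       \row_(i < r) (alpha ((tiso t x)^-1%VF (delta_mx 0 i)) : R))).

Section Bundle.
Variables (R : realType) (n : nat) (M : smoothManifold R n) (r : nat).
Variable A : vectorBundle M r.

Definition bundle_atlas : set (chart R (n + r) (total_space (fiber A))) :=
  total_atlas (atlas M) (trivs A).

Definition dual_atlas :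
    set (chart R (n + r) (total_space (dual_fiber (fiber A)))) :=
  total_atlas (atlas M) (@dual_triv R r M (fiber A) @` trivs A).

Definition smooth_section (s : forall x, fiber A x) : Prop :=
  smooth_map (atlas M) bundle_atlas
    (fun x => existT (fun x => fiber A x) x (s x)).

(* d/dt F (a + t b) at t = 0, for a and b in the fiber over x *)
Definition fiber_derivative (F : total_space (fiber A) -> R) (x : M)
    (a b : fiber A x) : R :=
  derive1
    (fun t : R => F (existT (fun x => fiber A x) x (a + t *: b)) : R^o) 0.

(* The fiber derivative of a smooth function is linear in its direction, so
   that [linfun] only packages it as an element of the dual fiber. *)
Definition legendre (L : total_space (fiber A) -> R)
    (a : total_space (fiber A)) : total_space (dual_fiber (fiber A)) :=
  existT (fun x => dual_fiber (fiber A) x) (bundle_proj a)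
    (linfun (fiber_derivative L (projT2 a) : fiber A (bundle_proj a) -> R^o)).

Definition regular_lagrangian (L : total_space (fiber A) -> R) : Prop :=
  diffeomorphism bundle_atlas dual_atlas (legendre L).

(* y^k dF/dy^k at a is the derivative of F at a in the fiber direction a *)
Definition euler_field :
    (total_space (fiber A) -> R) -> (total_space (fiber A) -> R) :=
  fun F a => fiber_derivative F (projT2 a) (projT2 a).

Definition energy (L : total_space (fiber A) -> R) :
    total_space (fiber A) -> R :=
  fun a => euler_field L a - L a.

Record lieAlgebroid := LieAlgebroid {
  bracket : (forall x, fiber A x) -> (forall x, fiber A x) ->
            (forall x, fiber A x);
  anchor : forall x, fiber A x -> (M -> R) -> R;
  bracket_smooth : forall s t, smooth_section s -> smooth_section t ->
    smooth_section (bracket s t);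
  bracket_linear_l : forall (k : R) s t u,
    smooth_section s -> smooth_section t -> smooth_section u ->
    forall x, bracket (fun y => k *: s y + t y) u x
              = k *: bracket s u x + bracket t u x;
  bracket_linear_r : forall (k : R) s t u,
    smooth_section s -> smooth_section t -> smooth_section u ->
    forall x, bracket s (fun y => k *: t y + u y) x
              = k *: bracket s t x + bracket s u x;
  bracket_alternating : forall s, smooth_section s ->
    forall x, bracket s s x = 0;
  bracket_jacobi : forall s t u,
    smooth_section s -> smooth_section t -> smooth_section u ->
    forall x, bracket s (bracket t u) x + bracket t (bracket u s) x
              + bracket u (bracket s t) x = 0;
  anchor_tangent : forall x (a : fiber A x),
    tangent_vector (atlas M) x (anchor a);
  anchor_linear : forall x (k : R) (a b : fiber A x) f,
    smooth_fun (atlas M) f ->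
    anchor (k *: a + b) f = k * anchor a f + anchor b f;
  (* smoothness of the anchor as a map into TM: in each chart of M its
     components with respect to d/dx^i are smooth functions on the part of the
     total space over that chart *)
  anchor_smooth : forall c, atlas M c ->
    exists w : total_space (fiber A) -> 'rV[R]_n,
    smooth_within bundle_atlas (@bundle_proj R M (fiber A) @^-1` cdom c) w /\
    forall a, cdom c (bundle_proj a) -> forall f, smooth_fun (atlas M) f ->
      anchor (projT2 a) f = coord_vector c (bundle_proj a) (w a) f;
  bracket_leibniz : forall f s t, smooth_fun (atlas M) f ->
    smooth_section s -> smooth_section t ->
    forall x, bracket s (fun y => f y *: t y) x
              = f x *: bracket s t x + anchor (s x) f *: t x }.

Arguments anchor l {x} _ _.

Definition semispray (LA : lieAlgebroid)
    (V : (total_space (fiber A) -> R) -> (total_space (fiber A) -> R)) : Prop :=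
  vector_field bundle_atlas V /\
  forall (a : total_space (fiber A)) (f : M -> R), smooth_fun (atlas M) f ->
    tangent_map (@bundle_proj R M (fiber A)) (fun F => V F a) f
    = anchor LA (projT2 a) f.

End Bundle.

Arguments bundle_atlas {R n M r} A _.
Arguments dual_atlas {R n M r} A _.

(* Main.v *)
(* The Poisson bracket on A is the pullback, by the Legendre transform, of the
   linear Poisson bracket on the dual bundle A^*. For a section s of A let l_s be
   the fiberwise linear function alpha |-> <alpha, s> on A^*. At every point,
   each smooth function on A^* agrees to first order with some l_s + f, where f
   is pulled back from M, and
     {l_s + f, l_t + g} = l_[s,t] + rho(s) g - rho(t) f
   defines a bracket on all smooth functions, because the right-hand side
   vanishes wherever l_s + f is stationary. The Jacobi identity for the functions
   l_s + f is that of the semidirect product of the sections of A with the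
   functions on M. It holds for all functions because the Jacobiator at a point
   only depends on differentials, by the symmetry of second derivatives.
   Finally, dE_L = y^k dp_k - (dL/dx^i) dx^i with p_k = dL/dy^k, so at a in A the
   energy agrees to first order with the pullback of some l_s + f such that s
   takes the value a; hence {E_L + f, g} = rho(a) g at a for all f and g on M. *)
From HB Require Import structures.
From mathcomp Require Import all_boot all_order all_algebra.
From mathcomp Require Import all_classical all_reals all_analysis.
From mathcomp Require Import ring lra.
Require Import Defs.
Set Implicit Arguments. Unset Strict Implicit. Unset Printing Implicit Defensive.
Import Order.TTheory GRing.Theory Num.Theory numFieldNormedType.Exports.
Local Open Scope classical_set_scope.
Local Open Scope ring_scope.

(** * Closure properties of C^k functions *)

Section Calculus.
Variable R : realType.
Implicit Types V W E : normedModType R.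

(** The axioms of a Lie algebroid concern global smooth sections and functions, whereas every
    argument is local. Bump functions bridge the gap: frames and coordinates are cut off to global
    objects, and the Hausdorff property of M makes the cutoffs smooth. On A and on its dual only
    charts are available; the differential of a function is never formed as an object, only its
    vanishing at a point is expressed. The bracket of two functions is defined point by point from
    chosen first-order data, so such choices say nothing about smoothness or second derivatives. For
    these, the bracket is expanded in one frame that is valid on a whole neighbourhood. Smoothness
    is defined through directional derivatives of all orders, so the symmetry of second derivatives
    is derived here from the mean value theorem. The Jacobi identity of the semidirect product needs
    the anchor to be a morphism of Lie algebras. This is not among the axioms and is deduced from
    the Jacobi identity and the Leibniz rule of the sections. *)

Lemma near_eq_differentiable V W (f g : V -> W) x :
  (\near x, f x = g x) -> differentiable f x -> differentiable g x.
Proof.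
move=> fg df.
have fgx : f x = g x := nbhs_singleton fg.
(* The differential of [f] satisfies the first-order expansion of [g], so by uniqueness it is the
   differential of [g]. *)
have key : g \o shift x = cst (g x) + 'd f x +o_ 0 id.
  have /eqaddoP H := diff_locally df.
  apply/eqaddoP => e e0; have := H _ e0.
  have fg0 : \forall y \near (0 : V), f (y + x) = g (y + x).
    have := fg; rewrite (near_shift 0) => fg'.
    by apply: filterS fg' => y /=; rewrite subr0.
  apply: filterS2 fg0 => y /= fgy.
  by rewrite !fctE /= fgy fgx.
apply/diff_locallyP; split.
  by rewrite (diff_unique (diff_continuous df) key); exact: diff_continuous.
by rewrite (diff_unique (diff_continuous df) key).
Qed.

(** Openness of [U] turns equality on [U] into equality near each point, which directional
    derivatives respect. The closure properties below use it to replace a derivative by its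
    formula. *)
Lemma eq_Ck_on V W k (U : set V) (f g : V -> W) : open U ->
  (forall x, U x -> f x = g x) -> Ck_on k U f -> Ck_on k U g.
Proof.
move=> oU; elim: k f g => [|k IH] f g fg /=.
  move=> fc x Ux; have fgn : \near x, f x = g x.
    by apply: filterS (open_nbhs_nbhs (conj oU Ux)) => y; exact: fg.
  suff : g @ x --> f x by rewrite (fg _ Ux).
  by apply: cvg_trans (fc x Ux); apply: near_eq_cvg.
have fgn x : U x -> \near x, f x = g x.
  by move=> Ux; apply: filterS (open_nbhs_nbhs (conj oU Ux)) => y; exact: fg.
move=> [df Df]; split=> [x Ux|v].
  exact: near_eq_differentiable (fgn _ Ux) (df _ Ux).
by apply: IH (Df v) => x Ux; exact: near_eq_derive (fgn _ Ux).
Qed.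

Lemma sub_Ck_on V W k (U U' : set V) (f : V -> W) :
  U `<=` U' -> Ck_on k U' f -> Ck_on k U f.
Proof.
move=> UU'; elim: k f => [|k IH] f /= => [fc x /UU'|[df Df]]; first exact: fc.
by split=> [x /UU'|v]; [exact: df|exact: IH].
Qed.

Lemma Ck_onS V W k (U : set V) (f : V -> W) : Ck_on k.+1 U f -> Ck_on k U f.
Proof.
elim: k f => [|k IH] f [df Df].
  by move=> x Ux; exact: differentiable_continuous (df _ Ux).
by split=> // v; exact: IH.
Qed.

Lemma Ck_on_cst V W k (U : set V) (w : W) : Ck_on k U (cst w).
Proof.
elim: k w => [|k IH] w; first by move=> x _; exact: cst_continuous.
split=> [x _|v]; first exact: differentiable_cst.
rewrite (_ : (fun x => _) = cst 0) //.
by apply/funext => x; rewrite derive_cst.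
Qed.

Lemma Ck_on_id V k (U : set V) : Ck_on k U (fun x : V => x).
Proof.
case: k => [|k]; first by move=> x _; exact: cvg_id.
split=> [x _|v]; first exact: ex_diff.
rewrite (_ : (fun x => _) = cst v); first exact: Ck_on_cst.
by apply/funext => x; rewrite derive_id.
Qed.

Lemma Ck_onD V W k (U : set V) (f g : V -> W) : open U ->
  Ck_on k U f -> Ck_on k U g -> Ck_on k U (fun x => f x + g x).
Proof.
move=> oU; elim: k f g => [|k IH] f g /=.
  by move=> fc gc x Ux; apply: continuousD; [exact: fc|exact: gc].
move=> [df Df] [dg Dg]; split=> [x Ux|v].
  by apply: differentiableD; [exact: df|exact: dg].
apply: eq_Ck_on oU _ (IH _ _ (Df v) (Dg v)) => x Ux /=.
by rewrite -deriveD //; apply: diff_derivable; [exact: df|exact: dg].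
Qed.

Lemma Ck_onM V k (U : set V) (f g : V -> R) : open U ->
  Ck_on k U f -> Ck_on k U g -> Ck_on k U (fun x => f x * g x).
Proof.
move=> oU; elim: k f g => [|k IH] f g.
  by move=> fc gc x Ux; apply: continuousM; [exact: fc|exact: gc].
move=> Cf Cg; have [df Df] := Cf; have [dg Dg] := Cg; split=> [x Ux|v].
  by apply: differentiableM; [exact: df|exact: dg].
apply: (@eq_Ck_on _ _ _ _ (fun x => f x * 'D_v g x + g x * 'D_v f x)) => //.
  move=> x Ux.
  by rewrite -[RHS]/('D_v (f * g) x) deriveM //;
    apply: diff_derivable; [exact: df|exact: dg].
by apply: Ck_onD => //; apply: IH => //; by [exact: Ck_onS|exact: Df|exact: Dg].
Qed.

Lemma Ck_on_linear V E W k (U : set V) (phi : {linear E -> W}) (g : V -> E) :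
  open U -> continuous phi -> Ck_on k U g -> Ck_on k U (fun x => phi (g x)).
Proof.
move=> oU cphi; elim: k g => [|k IH] g.
  by move=> gc x Ux; apply: (@continuous_comp _ _ _ g phi); [exact: gc|exact: cphi].
move=> [dg Dg]; split=> [x Ux|v].
  apply: (@differentiable_comp _ _ E W g phi); first exact: dg.
  exact: linear_differentiable.
apply: eq_Ck_on oU _ (IH _ (Dg v)) => x Ux /=.
have dphi : differentiable phi (g x) by exact: linear_differentiable.
rewrite [RHS](deriveE _ (differentiable_comp (dg _ Ux) dphi)).
rewrite (diff_comp (dg _ Ux) dphi) /= diff_lin //.
by rewrite deriveE //; exact: dg.
Qed.

Lemma Ck_on_sum V W k (U : set V) (I : Type) (s : seq I) (f : I -> V -> W) :
  open U -> (forall i, Ck_on k U (f i)) -> Ck_on k U (fun x => \sum_(i <- s) f i x).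
Proof.
move=> oU Hf; elim: s => [|i s IH].
  rewrite (_ : (fun x => _) = cst 0); first exact: Ck_on_cst.
  by apply/funext => x; rewrite big_nil.
rewrite (_ : (fun x => _) = (fun x => f i x + \sum_(i <- s) f i x)).
  exact: Ck_onD.
by apply/funext => x; rewrite big_cons.
Qed.

(* The intermediate space has the finite basis b, with dual basis phi, so that the
   chain rule expresses derivatives of [f \o g] as finite sums of products. *)
Lemma Ck_on_comp V E m (b : 'I_m -> E) (phi : 'I_m -> {linear E -> R^o}) k
    (O : set E) (U : set V) (f : E -> R) (g : V -> E) :
  open U -> (forall i, continuous (phi i)) ->
  (forall z, z = \sum_i phi i z *: b i) ->
  (forall x, U x -> O (g x)) ->
  Ck_on k O f -> Ck_on k U g -> Ck_on k U (fun x => f (g x)).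
Proof.
move=> oU cphi bphi UO; elim: k f g UO => [|k IH] f g UO.
  by move=> fc gc x Ux; apply: (@continuous_comp _ _ _ g f); [exact: gc|exact/fc/UO].
move=> Cf Cg; have [df Df] := Cf; have [dg Dg] := Cg; split=> [x Ux|v].
  by apply: differentiable_comp; [exact: dg|exact/df/UO].
apply: (@eq_Ck_on _ _ _ _
  (fun x => \sum_i (phi i ('D_v g x) : R) * 'D_(b i) f (g x))) => //.
  move=> x Ux; have dfx := df _ (UO _ Ux).
  rewrite [RHS](deriveE _ (differentiable_comp (dg _ Ux) dfx)).
  rewrite (diff_comp (dg _ Ux) dfx) /= -(deriveE _ (dg _ Ux)).
  rewrite {2}(bphi ('D_v g x)) linear_sum; apply: eq_bigr => i _.
  by rewrite linearZ /= (deriveE (b i) dfx).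
apply: Ck_on_sum => // i; apply: Ck_onM => //.
  by apply: (@Ck_on_linear _ _ R^o _ _ (phi i)); [|exact: cphi|exact: Dg].
apply: (IH _ g UO (Df (b i))); exact: Ck_onS.
Qed.

Lemma Ck_onV V k (U : set V) (f : V -> R) : open U ->
  (forall x, U x -> f x != 0) ->
  Ck_on k U f -> Ck_on k U (fun x => (f x)^-1).
Proof.
move=> oU f0; elim: k f f0 => [|k IH] f f0.
  by move=> fc x Ux; apply: (@cvgV _ _ _ _ f); [exact: f0|exact: fc].
move=> Cf; have [df Df] := Cf; split=> [x Ux|v].
  by apply: differentiableV; [exact: df|exact: f0].
apply: (@eq_Ck_on _ _ _ _ (fun x => ((f x)^-1 * (f x)^-1) * ((-1) * 'D_v f x))) => //.
  move=> x Ux; rewrite deriveV ?f0 //; last exact/diff_derivable/df.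
  by rewrite mulN1r mulrN -invfM -expr2 scaleNr.
have CfV : Ck_on k U (fun x => (f x)^-1) by apply: IH => //; exact: Ck_onS.
apply: (Ck_onM oU (Ck_onM oU CfV CfV)).
apply: (Ck_onM oU _ (Df v)); exact: Ck_on_cst.
Qed.

End Calculus.

(** * Smooth functions at a point and symmetry of second derivatives *)

Section SmoothAt.
Variable R : realType.
Implicit Types V W E : normedModType R.

Lemma near_open (T : topologicalType) (x : T) (P : T -> Prop) :
  (\forall y \near x, P y) -> exists O, [/\ open O, O x & forall y, O y -> P y].
Proof. by move=> xP; have : nbhs x P := xP; rewrite nbhsE => -[ O [oO Ox] OP]; exists O. Qed.

(** One neighbourhood serves all orders k. Smoothness thus becomes a property of germs that
    differentiation preserves. *)
Definition smooth_at V W (f : V -> W) (x : V) : Prop :=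
  exists U, [/\ open U, U x & smooth_on U f].

Lemma Ck_on_local V W k (U : set V) (f : V -> W) :
  (forall x, U x -> exists O, [/\ open O, O x & Ck_on k O f]) -> Ck_on k U f.
Proof.
elim: k f => [|k IH] f locf.
  by move=> x /locf[ O [_ Ox]]; apply.
split=> [x /locf[ O [_ Ox [df _]]]|v]; first exact: df.
by apply: IH => x /locf[ O [oO Ox [_ Df]]]; exists O; split; last exact: Df.
Qed.

Lemma smooth_at_on V W (U : set V) (f : V -> W) x :
  open U -> U x -> smooth_on U f -> smooth_at f x.
Proof. by move=> oU Ux sf; exists U. Qed.

Lemma smooth_onP V W (U : set V) (f : V -> W) : open U ->
  smooth_on U f <-> (forall x, U x -> smooth_at f x).
Proof.
move=> oU; split=> [sf x Ux|locf k]; first exact: smooth_at_on sf.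
by apply: Ck_on_local => x /locf[ O [oO Ox sf]]; exists O.
Qed.

Lemma near_eq_smooth_at V W (f g : V -> W) x :
  (\near x, f x = g x) -> smooth_at f x -> smooth_at g x.
Proof.
move=> /near_open[ O [oO Ox fg]] [U [oU Ux sf]].
exists (O `&` U); split; [exact: openI|by []|move=> k].
apply: (eq_Ck_on (openI oO oU)) => [y [Oy _]|]; first exact: fg Oy.
by apply: sub_Ck_on (sf k) => y [].
Qed.

Lemma smooth_at_near V W (f : V -> W) x : smooth_at f x -> \forall y \near x, smooth_at f y.
Proof.
move=> [U [oU Ux sf]]; apply: filterS (open_nbhs_nbhs (conj oU Ux)) => y Uy.
by exists U.
Qed.

Lemma smooth_at_differentiable V W (f : V -> W) x : smooth_at f x -> differentiable f x.
Proof. by move=> [U [_ Ux /(_ 1%N) [df _]]]; exact: df. Qed.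

Lemma smooth_at_derivable V W (f : V -> W) x v : smooth_at f x -> derivable f x v.
Proof. by move/smooth_at_differentiable/diff_derivable; apply. Qed.

Lemma smooth_at_continuous V W (f : V -> W) x : smooth_at f x -> {for x, continuous f}.
Proof. by move/smooth_at_differentiable/differentiable_continuous. Qed.

Lemma smooth_at_derive V W (f : V -> W) x v :
  smooth_at f x -> smooth_at (fun y => 'D_v f y) x.
Proof.
move=> [U [oU Ux sf]]; exists U; split=> // k.
by have [_] := sf k.+1; apply.
Qed.

Lemma smooth_at_cst V W (w : W) (x : V) : smooth_at (cst w) x.
Proof. by exists setT; split; [exact: openT| |move=> k; exact: Ck_on_cst]. Qed.

Lemma smooth_at_id V (x : V) : smooth_at (fun y : V => y) x.
Proof. by exists setT; split; [exact: openT| |move=> k; exact: Ck_on_id]. Qed.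

Lemma smooth_atD V W (f g : V -> W) x :
  smooth_at f x -> smooth_at g x -> smooth_at (fun y => f y + g y) x.
Proof.
move=> [U [oU Ux sf]] [ O [oO Ox sg]]; have oI := openI oU oO.
exists (U `&` O); split=> // k.
by apply: Ck_onD => //; [apply: sub_Ck_on (sf k) => y []|apply: sub_Ck_on (sg k) => y []].
Qed.

Lemma smooth_atM V (f g : V -> R) x :
  smooth_at f x -> smooth_at g x -> smooth_at (fun y => f y * g y) x.
Proof.
move=> [U [oU Ux sf]] [ O [oO Ox sg]]; have oI := openI oU oO.
exists (U `&` O); split=> // k.
by apply: Ck_onM => //; [apply: sub_Ck_on (sf k) => y []|apply: sub_Ck_on (sg k) => y []].
Qed.

Lemma smooth_at_sum V W (I : Type) (s : seq I) (f : I -> V -> W) x :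
  (forall i, smooth_at (f i) x) -> smooth_at (fun y => \sum_(i <- s) f i y) x.
Proof.
move=> sf; elim: s => [|i s IH].
  rewrite (_ : (fun y => _) = cst 0); first exact: smooth_at_cst.
  by apply/funext => y; rewrite big_nil.
rewrite (_ : (fun y => _) = (fun y => f i y + \sum_(i <- s) f i y)).
  exact: smooth_atD.
by apply/funext => y; rewrite big_cons.
Qed.

Lemma smooth_atN V (f : V -> R) x : smooth_at f x -> smooth_at (fun y => - f y) x.
Proof.
move=> sf; rewrite (_ : (fun y => _) = (fun y => -1 * f y)).
  by apply: smooth_atM => //; exact: smooth_at_cst.
by apply/funext => y; rewrite mulN1r.
Qed.

Lemma smooth_atB V (f g : V -> R) x :
  smooth_at f x -> smooth_at g x -> smooth_at (fun y => f y - g y) x.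
Proof. by move=> sf sg; apply: smooth_atD => //; exact: smooth_atN. Qed.

Lemma smooth_atV V (f : V -> R) x : f x != 0 ->
  smooth_at f x -> smooth_at (fun y => (f y)^-1) x.
Proof.
move=> fx0 sf; have [U [oU Ux sfU]] := sf.
have : \forall y \near x, f y != 0.
  exact: cvgr_neq0 (smooth_at_continuous sf) fx0.
move=> /near_open[ O [oO Ox f0]].
exists (O `&` U); split; [exact: openI|by []|move=> k].
apply: Ck_onV; [exact: openI|by move=> y [/f0]|].
by apply: sub_Ck_on (sfU k) => y [].
Qed.

Lemma smooth_at_linear V E W (phi : {linear E -> W}) (g : V -> E) x :
  continuous phi -> smooth_at g x -> smooth_at (fun y => phi (g y)) x.
Proof.
by move=> cphi [U [oU Ux sg]]; exists U; split=> // k; exact: Ck_on_linear.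
Qed.

(** The basis is a parameter because the intermediate space is R in one use and a space of row
    vectors in the other. *)
Lemma smooth_at_comp_basis V E m (b : 'I_m -> E) (phi : 'I_m -> {linear E -> R^o})
    (f : E -> R) (g : V -> E) x :
  (forall i, continuous (phi i)) -> (forall z, z = \sum_i phi i z *: b i) ->
  smooth_at f (g x) -> smooth_at g x -> smooth_at (fun y => f (g y)) x.
Proof.
move=> cphi bphi [ O [oO Ogx sf]] sg; have [U [oU Ux sgU]] := sg.
have : \forall y \near x, O (g y).
  by apply: (smooth_at_continuous sg); exact: open_nbhs_nbhs.
move=> /near_open[P [oP Px PO]].
exists (P `&` U); split; [exact: openI|by []|move=> k].
apply: (Ck_on_comp (openI oP oU) cphi bphi _ (sf k)) => [y [/PO]//|].
by apply: sub_Ck_on (sgU k) => y [].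
Qed.

Lemma smooth_at_comp1 V (f : R -> R) (g : V -> R) x :
  smooth_at f (g x) -> smooth_at g x -> smooth_at (fun y => f (g y)) x.
Proof.
apply: (@smooth_at_comp_basis _ R^o 1 (fun=> 1) (fun=> idfun)) => [_ z //|z].
by rewrite big_ord1; exact: esym (mulr1 z).
Qed.

Definition row_coord n (i : 'I_n) (u : 'rV[R]_n) : R^o := u 0 i.

Fact row_coord_linear n (i : 'I_n) : linear (@row_coord n i).
Proof. by move=> k u v; rewrite /row_coord !mxE. Qed.

HB.instance Definition _ n (i : 'I_n) :=
  GRing.isLinear.Build R 'rV[R]_n R^o *:%R (@row_coord n i) (@row_coord_linear n i).

Lemma row_coord_continuous n (i : 'I_n) : continuous (@row_coord n i).
Proof. exact: coord_continuous. Qed.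

Lemma smooth_at_comp V n (f : 'rV[R]_n -> R) (g : V -> 'rV[R]_n) x :
  smooth_at f (g x) -> smooth_at g x -> smooth_at (fun y => f (g y)) x.
Proof.
apply: (@smooth_at_comp_basis _ _ _ (fun i => delta_mx 0 i) (fun i => @row_coord n i)).
  by move=> i; exact: row_coord_continuous.
by move=> z; exact: row_sum_delta.
Qed.

Definition scale_vector W (w : W) (k : R^o) : W := k *: w.

Fact scale_vector_linear W (w : W) : linear (scale_vector w).
Proof. by move=> k u v; rewrite /scale_vector scalerDl scalerA. Qed.

HB.instance Definition _ W (w : W) :=
  GRing.isLinear.Build R R^o W *:%R (scale_vector w) (scale_vector_linear w).

Lemma smooth_atZl V W (w : W) (f : V -> R) x :
  smooth_at f x -> smooth_at (fun y => f y *: w) x.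
Proof. by apply: (smooth_at_linear (phi := scale_vector w)); exact: scalel_continuous. Qed.

Lemma smooth_at_rowP V n (g : V -> 'rV[R]_n) x :
  smooth_at g x <-> (forall i, smooth_at (fun y => g y 0 i : R) x).
Proof.
split=> [sg i|sg].
  exact: (smooth_at_linear (phi := @row_coord n i) (@row_coord_continuous n i) sg).
rewrite (_ : g = fun y => \sum_i g y 0 i *: (delta_mx 0 i : 'rV[R]_n)).
  by apply: smooth_at_sum => i; exact: smooth_atZl.
by apply/funext => y; exact: row_sum_delta.
Qed.

Lemma smooth_at_comp_row V n m (f : 'rV[R]_n -> 'rV[R]_m) (g : V -> 'rV[R]_n) x :
  smooth_at f (g x) -> smooth_at g x -> smooth_at (fun y => f (g y)) x.
Proof.
move=> /smooth_at_rowP sf sg; apply/smooth_at_rowP => i.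
exact: (smooth_at_comp (f := fun z => f z 0 i)).
Qed.

Lemma derive_comp V E W (f : E -> W) (g : V -> E) x v :
  smooth_at f (g x) -> smooth_at g x ->
  'D_v (fun y => f (g y)) x = 'D_('D_v g x) f (g x).
Proof.
move=> /smooth_at_differentiable df /smooth_at_differentiable dg.
rewrite [LHS](deriveE _ (differentiable_comp dg df)) (diff_comp dg df) /=.
by rewrite !deriveE.
Qed.

Lemma derive_linear_fun V (k : R) (f g : V -> R) x v : smooth_at f x -> smooth_at g x ->
  'D_v (fun y => k * f y + g y) x = k * 'D_v f x + 'D_v g x.
Proof.
move=> /(smooth_at_derivable (v := v)) df /(smooth_at_derivable (v := v)) dg.
rewrite -[LHS]/('D_v ((k \*: f) + g) x) deriveD //; last exact: derivableZ.
by rewrite deriveZ.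
Qed.

Lemma derive_add_fun V (f g : V -> R) x v : smooth_at f x -> smooth_at g x ->
  'D_v (fun y => f y + g y) x = 'D_v f x + 'D_v g x.
Proof. by move=> sf sg; rewrite -[LHS]/('D_v (f + g) x) deriveD //; exact: smooth_at_derivable. Qed.

Lemma derive_sub_fun V (f g : V -> R) x v : smooth_at f x -> smooth_at g x ->
  'D_v (fun y => f y - g y) x = 'D_v f x - 'D_v g x.
Proof. by move=> sf sg; rewrite -[LHS]/('D_v (f - g) x) deriveB //; exact: smooth_at_derivable. Qed.

Lemma derive_sum_fun V (I : Type) (s : seq I) (f : I -> V -> R) x v :
  (forall i, smooth_at (f i) x) ->
  'D_v (fun y => \sum_(i <- s) f i y) x = \sum_(i <- s) 'D_v (f i) x.
Proof.
move=> sf; elim: s => [|i s IH].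
  rewrite big_nil (_ : (fun y => _) = cst 0) ?derive_cst //.
  by apply/funext => y; rewrite big_nil.
rewrite big_cons -IH (_ : (fun y => _) = (fun y => 1 * f i y + \sum_(j <- s) f j y)).
  by rewrite derive_linear_fun ?mul1r //; exact: smooth_at_sum.
by apply/funext => y; rewrite big_cons mul1r.
Qed.

Lemma derive_mul_fun V (f g : V -> R) x v : smooth_at f x -> smooth_at g x ->
  'D_v (fun y => f y * g y) x = 'D_v f x * g x + f x * 'D_v g x.
Proof.
move=> /(smooth_at_derivable (v := v)) df /(smooth_at_derivable (v := v)) dg.
rewrite -[LHS]/('D_v (f * g) x) deriveM // addrC; congr (_ + _).
exact: mulrC.
Qed.

Lemma derive_row_sum n W (f : 'rV[R]_n -> W) x v : smooth_at f x ->
  'D_v f x = \sum_i v 0 i *: 'D_(delta_mx 0 i) f x.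
Proof.
move=> /smooth_at_differentiable df.
rewrite deriveE // {1}(row_sum_delta v) linear_sum; apply: eq_bigr => i _.
by rewrite linearZ /= deriveE.
Qed.

Lemma derive_row V n (g : V -> 'rV[R]_n) x v i : smooth_at g x ->
  ('D_v g x) 0 i = 'D_v (fun y => g y 0 i : R) x.
Proof.
move=> sg; rewrite derive_mx; last exact: smooth_at_derivable.
by rewrite mxE.
Qed.

Lemma derive_shift_arg V W (f : V -> W) (w u y : V) :
  'D_u (fun z => f (z + w)) y = 'D_u f (y + w).
Proof.
rewrite /derive; congr (lim _).
set g1 := fun h => _; set g2 := fun h => _; suff -> : g1 = g2 by [].
by apply/funext => h; rewrite /g1 /g2 /= addrA.
Qed.

Lemma differentiable_shift_arg V W (f : V -> W) (w y : V) :
  differentiable f (y + w) -> differentiable (fun z => f (z + w)) y.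
Proof.
move=> df; apply: (@differentiable_comp _ _ _ _ (fun z => z + w) f) => //.
Qed.

Lemma mean_value_line V (f : V -> R) (x u : V) (h : R) : 0 < h ->
  (forall s, 0 <= s <= h -> differentiable f (x + s *: u)) ->
  exists2 s, 0 <= s <= h & f (x + h *: u) - f x = h * 'D_u f (x + s *: u).
Proof.
move=> h0 df.
pose g (s : R) : R := f (x + s *: u).
have dg s : 0 <= s <= h -> is_derive s 1 g ('D_u f (x + s *: u)).
  move=> /df dfs.
  have dl : is_diff s (fun s : R => x + s *: u) (fun s : R => 0 + s *: u).
    exact: (is_diffD (is_diff_cst x s) (is_diff_scalel s u)).
  have dls : differentiable (fun s : R => x + s *: u) s by exact: ex_diff.
  have dgs : differentiable g s := differentiable_comp dls dfs.
  apply: DeriveDef; first exact: diff_derivable.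
  rewrite deriveE // [X in X 1 = _](diff_comp dls dfs) /=.
  by rewrite diff_val add0r scale1r deriveE.
have [||c] := @MVT R g (fun s => 'D_u f (x + s *: u)) 0 h h0.
- move=> s; rewrite in_itv /= => /andP[s0 sh]; apply: dg; by rewrite !ltW.
- apply: derivable_within_continuous => s; rewrite in_itv /= => sh.
  by have [] := dg _ sh.
- rewrite in_itv /= => /andP[c0 ch] E; exists c; first by rewrite !ltW.
  by move: E; rewrite /g scale0r addr0 subr0 mulrC.
Qed.

(* The increment is that of [y |-> f (y + h *: v) - f y]: the mean value theorem
   is applied to it along u, and then to ['D_u f] along v. *)
Lemma second_difference V (f : V -> R) (x u v : V) (h : R) : 0 < h ->
  (forall s t, 0 <= s <= h -> 0 <= t <= h -> smooth_at f (x + s *: u + t *: v)) ->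
  exists s t, [/\ 0 <= s <= h, 0 <= t <= h &
   (f (x + h *: u + h *: v) - f (x + h *: u)) - (f (x + h *: v) - f x) =
     h * h * 'D_v (fun y => 'D_u f y) (x + s *: u + t *: v)].
Proof.
move=> h0 sf.
have hh : 0 <= h <= h by apply/andP; split; lra.
have h00 : 0 <= (0 : R) <= h by apply/andP; split; lra.
pose F y := f (y + h *: v) - f y.
have df s : 0 <= s <= h -> differentiable f (x + s *: u).
  by move=> sh; have /smooth_at_differentiable := sf _ _ sh h00; rewrite scale0r addr0.
have dfv s : 0 <= s <= h -> differentiable (fun y => f (y + h *: v)) (x + s *: u).
  by move=> sh; apply/differentiable_shift_arg/smooth_at_differentiable/sf.
have [s sh|s sh E] := @mean_value_line V F x u h h0.
  by apply: differentiableB; [exact: dfv|exact: df].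
have DF : 'D_u F (x + s *: u) =
    'D_u f (x + s *: u + h *: v) - 'D_u f (x + s *: u).
  by rewrite deriveB ?derive_shift_arg //; apply: diff_derivable; [exact: dfv|exact: df].
have [t th|t th E'] := @mean_value_line V (fun y => 'D_u f y) (x + s *: u) v h h0.
  by apply/smooth_at_differentiable/smooth_at_derive/sf.
exists s, t; split=> //.
by move: E; rewrite /F DF E' mulrA.
Qed.

(** The points [p] and [q] may differ: two applications of the mean value theorem yield equal
    values, each at an intermediate point of its own. *)
Lemma eq_continuous_near V (a b : V -> R) (x : V) :
  {for x, continuous a} -> {for x, continuous b} ->
  (forall d, 0 < d -> exists p q, [/\ ball x d p, ball x d q & a p = b q]) ->
  a x = b x.
Proof.
move=> ca cb ab; apply/eqP; rewrite -subr_eq0 -normr_le0.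
apply/ler_addgt0Pr => e e0; rewrite add0r.
have e2 : 0 < e / 2 by rewrite divr_gt0.
have na : \forall y \near x, `|a x - a y| <= e / 2.
  by move/cvgrPdist_le: ca => /(_ _ e2).
have nb : \forall y \near x, `|b x - b y| <= e / 2.
  by move/cvgrPdist_le: cb => /(_ _ e2).
have /nbhs_ballP[d /= d0 xd] : \forall y \near x,
    `|a x - a y| <= e / 2 /\ `|b x - b y| <= e / 2 by apply: filterS2 na nb.
have [p [q [/xd[ap _] /xd[_ bq] apq]]] := ab _ d0.
rewrite (_ : a x - b x = (a x - a p) - (b x - b q)); last by rewrite apq; ring.
by rewrite (le_trans (ler_normB _ _)) // [e]splitr lerD.
Qed.

(** The second difference along u and v is symmetric in u and v. Evaluated in both orders, it yields
    a value of each mixed derivative at points arbitrarily close to x. *)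
Lemma derive_schwarz V (f : V -> R) (x u v : V) : smooth_at f x ->
  'D_u (fun y => 'D_v f y) x = 'D_v (fun y => 'D_u f y) x.
Proof.
move=> sf; apply: (@eq_continuous_near _ (fun y => 'D_u (fun y => 'D_v f y) y)
  (fun y => 'D_v (fun y => 'D_u f y) y)).
- exact: smooth_at_continuous (smooth_at_derive u (smooth_at_derive v sf)).
- exact: smooth_at_continuous (smooth_at_derive v (smooth_at_derive u sf)).
move=> d1 d10.
have /nbhs_ballP[d2 /= d20 xd] := smooth_at_near sf.
pose d := Num.min d1 d2.
have d0 : 0 < d by rewrite lt_min d10.
(* The parallelogram with sides h u and h v stays within distance d/2 of x; the summand 1 keeps the
   divisor positive when u = v = 0. *)
pose h := d / (1 + `|u| + `|v|) / 2.
have c0 : 0 < 1 + `|u| + `|v| by rewrite -addrA ltr_pwDl ?addr_ge0.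
have h0 : 0 < h by rewrite !divr_gt0.
have near_x s t : 0 <= s <= h -> 0 <= t <= h -> ball x d (x + s *: u + t *: v).
  move=> /andP[s0 sh] /andP[t0 th]; rewrite -ball_normE /ball_ /=.
  rewrite -addrA opprD addNKr normrN (le_lt_trans (ler_normD _ _)) //.
  rewrite !normrZ (ger0_norm s0) (ger0_norm t0).
  apply: (@le_lt_trans _ _ (h * (`|u| + `|v|))).
    by rewrite mulrDr lerD // ler_wpM2r.
  apply: (@le_lt_trans _ _ (h * (1 + `|u| + `|v|))).
    by rewrite ler_pM2l // -addrA lerDr.
  by rewrite /h mulrAC divfK ?gt_eqF // ltr_pdivrMr // ltr_pMr // ltr1n.
have ball1 y : ball x d y -> ball x d1 y by apply: le_ball; rewrite ge_min lexx.
have ball2 y : ball x d y -> smooth_at f y.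
  by move=> xy; apply: xd; apply: le_ball xy; rewrite ge_min lexx orbT.
have [|s [t [sh th E]]] := @second_difference V f x u v h h0.
  by move=> s t sh th; exact/ball2/near_x.
have [|t' [s' [th' sh' E']]] := @second_difference V f x v u h h0.
  by move=> t2 s2 th2 sh2; rewrite addrAC; exact/ball2/near_x.
exists (x + s' *: u + t' *: v), (x + s *: u + t *: v).
split; [exact/ball1/near_x|exact/ball1/near_x|].
apply: (@mulfI _ (h * h)); first by rewrite mulf_neq0 ?gt_eqF.
apply: etrans E; move: E'.
rewrite (addrAC x (h *: v)) (addrAC x (t' *: v)) => E'; apply: etrans (esym E') _.
by ring.
Qed.

End SmoothAt.

(** * Bump functions on R^n *)

Section Bump.
Variable R : realType.

(** The function exp(-1/t) / t^m, extended by 0. The span of the whole family is closed under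
    differentiation, so smoothness follows by induction on the order, for all m at once. *)
Definition flat (m : nat) (t : R) : R :=
  if 0 < t then t^-1 ^+ m * expR (- t^-1) else 0.

Lemma flat_ge0 m t : 0 <= flat m t.
Proof.
rewrite /flat; case: ifP => // t0.
by rewrite mulr_ge0 ?expR_ge0 // exprn_ge0 // invr_ge0 ltW.
Qed.

Lemma flat_eq0 m t : t <= 0 -> flat m t = 0.
Proof. by move=> t0; rewrite /flat ltNge t0. Qed.

(** With x = 1/t this is the bound exp x >= x^(m+2) / (m+2)!. Being quadratic in t, it makes the
    difference quotient at 0 tend to 0. *)
Lemma flat_le m (t : R) : 0 < t -> flat m t <= m.+2`!%:R * t ^+ 2.
Proof.
move=> t0; rewrite /flat t0; set x := t^-1.
have x0 : 0 < x by rewrite invr_gt0.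
have key : x ^+ m.+2 / m.+2`!%:R <= expR x.
  by apply: le_trans (expR_ge1Dxn m.+1 (ltW x0)); rewrite lerDr.
have F0 : 0 < m.+2`!%:R :> R by rewrite ltr0n fact_gt0.
rewrite expRN ler_pdivrMr ?expR_gt0 //.
have -> : x ^+ m = x ^+ m.+2 * t ^+ 2.
  by rewrite -addn2 exprD -mulrA -exprMn mulVf ?gt_eqF // expr1n mulr1.
rewrite [leRHS]mulrAC ler_pM2r ?exprn_gt0 //.
by rewrite -ler_pdivrMl // mulrC.
Qed.

Lemma is_derive_flat m (t : R) :
  is_derive t 1 (flat m) (flat m.+2 t - m%:R * flat m.+1 t).
Proof.
have [t0|t0|->] := ltgtP t 0.
- have /near_eq_is_derive : \near t, cst 0 t = flat m t.
    near=> s; rewrite flat_eq0 // ltW //.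
    by near: s; exact: lt_nbhsl.
  apply; rewrite !flat_eq0 ?ltW // mulr0 subr0; exact: is_derive_cst.
- pose g (s : R) := s^-1 ^+ m * expR (- s^-1).
  have /near_eq_is_derive : \near t, g t = flat m t.
    near=> s; rewrite /flat ifT //.
    by near: s; exact: lt_nbhsr.
  apply; have tn0 : t != 0 by rewrite gt_eqF.
  have dV : is_derive t 1 (fun s : R => s^-1) (- t ^- 2).
    apply: DeriveDef; first by apply: derivableV => //; exact: derivable_id.
    by rewrite deriveV // derive_id [LHS]mulr1.
  have dX : is_derive t 1 (fun s : R => s^-1 ^+ m) ((m%:R * t^-1 ^+ m.-1) *: - t ^- 2).
    have -> : (fun s : R => s^-1 ^+ m) = (fun s : R => s^-1) ^+ m.
      by apply/funext => s; rewrite exprfctE.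
    exact: is_deriveX.
  have dE : is_derive t 1 (fun s : R => expR (- s^-1)) (t ^- 2 * expR (- t^-1)).
    have dN : is_derive t 1 (fun s : R => - s^-1) (t ^- 2).
      by rewrite -[t ^- 2]opprK; exact: is_deriveN.
    have dN1 : derivable (fun s : R => - s^-1) t 1 by case: dN.
    have dfN : differentiable (fun s : R => - s^-1) t by apply/derivable1_diffP.
    have dfE : differentiable (@expR R) (- t^-1).
      by apply/derivable1_diffP; exact: derivable_expR.
    have dfC : differentiable (fun s : R => expR (- s^-1)) t.
      exact: (@differentiable_comp _ _ _ _ (fun s : R => - s^-1)).
    apply: DeriveDef; first by apply/derivable1_diffP.
    rewrite -derive1E (derive1_comp dN1) ?derivable_expR // !derive1E.
    have -> : 'D_1 (@expR R) (- t^-1) = expR (- t^-1).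
      by have /(congr1 (fun f : R -> R => f (- t^-1))) := @derive_expR R.
    by case: dN => _ ->; rewrite mulrC.
  have -> : flat m.+2 t - m%:R * flat m.+1 t =
     t^-1 ^+ m *: (t ^- 2 * expR (- t^-1)) +
     expR (- t^-1) *: ((m%:R * t^-1 ^+ m.-1) *: - t ^- 2).
    rewrite /flat t0 /GRing.scale /= -exprVn; set y := t^-1; set E := expR _.
    (* The power rule produces the exponent [m.-1], so m = 0 is treated apart. *)
    by case: (m) => [|k] /=; rewrite !exprS; ring.
  exact: is_deriveM.
- rewrite !(@flat_eq0 _ 0) // mulr0 subr0.
  have key : (fun h : R => h^-1 *: ((flat m \o shift 0) (h *: 1) - flat m 0)) @ 0^' --> 0.
    apply/cvgrPdist_le => e e0; near=> h.
    rewrite /= addr0 [h *: 1]mulr1 (@flat_eq0 m 0) // subr0 sub0r normrN.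
    have hn0 : h != 0 by near: h; exact: nbhs_dnbhs_neq.
    rewrite /GRing.scale /= normrM normfV ler_pdivrMl ?normr_gt0 // (ger0_norm (flat_ge0 _ _)).
    have [h0|h0] := ltP 0 h; last first.
      by rewrite /flat ltNge h0 /= mulr_ge0 // ltW.
    rewrite (le_trans (flat_le _ h0)) // expr2 mulrA (gtr0_norm h0) [leRHS]mulrC ler_pM2r //.
    have F0 : 0 < m.+2`!%:R :> R by rewrite ltr0n fact_gt0.
    rewrite -ler_pdivlMl // (le_trans (ler_norm h)) // ltW //.
    near: h; apply: dnbhs0_lt; by rewrite mulr_gt0 ?invr_gt0.
  apply: DeriveDef; first by apply/cvg_ex; exists 0.
  exact: cvg_lim key.
Unshelve. all: by end_near. Qed.

Lemma Ck_on_flat k m : Ck_on k setT (flat m).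
Proof.
have dflat n (t : R) : differentiable (flat n) t.
  by apply/derivable1_diffP; have [] := is_derive_flat n t.
elim: k m => [|k IH] m; first by move=> t _; exact: differentiable_continuous.
split=> [t _|v]; first exact: dflat.
rewrite (_ : (fun x => _) = fun t => v * (flat m.+2 t + (- m%:R) * flat m.+1 t)).
  apply: Ck_onM; [exact: openT|exact: Ck_on_cst|].
  apply: Ck_onD; [exact: openT|exact: IH|].
  by apply: Ck_onM; [exact: openT|exact: Ck_on_cst|exact: IH].
apply/funext => t; rewrite deriveE // -[v]mulr1 linearZ /= -deriveE //.
by have [_ ->] := is_derive_flat m t; rewrite mulr1 mulNr.
Qed.

(** The standard transition from 0 (for t <= 0) to 1 (for t >= 1). The denominator never vanishes,
    since t or 1 - t is positive. *)
Definition smooth_step (t : R) : R := flat 0 t / (flat 0 t + flat 0 (1 - t)).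

Lemma flat0_gt0 (t : R) : 0 < t -> 0 < flat 0 t.
Proof. by move=> t0; rewrite /flat t0 mul1r expR_gt0. Qed.

Lemma smooth_step0 t : t <= 0 -> smooth_step t = 0.
Proof. by move=> t0; rewrite /smooth_step {1}/flat ltNge t0 mul0r. Qed.

Lemma smooth_step1 t : 1 <= t -> smooth_step t = 1.
Proof.
move=> t1; rewrite /smooth_step [X in _ + X]/flat subr_gt0 ltNge t1 addr0 divff //.
by rewrite gt_eqF // flat0_gt0 // (lt_le_trans ltr01).
Qed.

Lemma smooth_at_step t : smooth_at smooth_step t.
Proof.
have sflat s : smooth_at (flat 0) s.
  by exists setT; split=> //; [exact: openT|move=> k; exact: Ck_on_flat].
apply: smooth_atM => //; apply: smooth_atV.
  have [t0|t0] := ltP 0 t.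
    by rewrite gt_eqF // ltr_pwDl ?flat0_gt0 ?flat_ge0.
  by rewrite gt_eqF // ltr_pwDr ?flat0_gt0 ?flat_ge0 // subr_gt0 (le_lt_trans t0).
apply: smooth_atD => //; apply: smooth_at_comp1 => //.
by apply: smooth_atB; [exact: smooth_at_cst|exact: smooth_at_id].
Qed.

(** The norm of row vectors is the maximum norm, which is not smooth, so a sum of squares [Q]
    replaces it. Outside the closed ball [K] a single coordinate already gives Q >= 1. Halving the
    radius keeps the closed ball inside an open ball contained in [O]. *)
Lemma exists_row_bump n (u0 : 'rV[R]_n) (O : set 'rV[R]_n) : open O -> O u0 ->
  exists (psi : 'rV[R]_n -> R) (K : set 'rV[R]_n),
    [/\ forall u, smooth_at psi u, \forall u \near u0, psi u = 1,
        compact K, K `<=` O & forall u, ~ K u -> psi u = 0].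
Proof.
move=> oO Ou0.
have /nbhs_ballP[d /= d0 dO] : nbhs u0 O by exact: open_nbhs_nbhs.
pose r := d / 2; have r0 : 0 < r by rewrite divr_gt0.
pose Q (u : 'rV[R]_n) : R := \sum_i ((u 0 i - u0 0 i) / r * ((u 0 i - u0 0 i) / r)).
have sQ u : smooth_at Q u.
  have s i : smooth_at (fun u : 'rV[R]_n => (u 0 i - u0 0 i) / r) u.
    apply: smooth_atM; last exact: smooth_at_cst.
    apply: smooth_atB; last exact: smooth_at_cst.
    by have /smooth_at_rowP := smooth_at_id u; exact.
  by apply: smooth_at_sum => i; exact: smooth_atM.
have Q0 : Q u0 = 0 by rewrite /Q big1 // => i _; rewrite subrr mul0r mul0r.
(* The argument 2 - 2 Q is at least 1 where Q <= 1/2 and at most 0 where Q >= 1. *)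
pose psi u := smooth_step (1 + 1 - Q u - Q u).
pose K := [set u : 'rV[R]_n | `|u0 - u| <= r].
have KE : K = closed_ball u0 r by rewrite closed_ballE.
exists psi, K; split.
- move=> u; apply: smooth_at_comp1; first exact: smooth_at_step.
  by apply: smooth_atB => //; apply: smooth_atB => //; exact: smooth_at_cst.
- have : \forall u \near u0, Q u < 2^-1.
    by apply: (cvgr_lt _ (smooth_at_continuous (sQ u0))); rewrite Q0 invr_gt0.
  apply: filterS => u Qu; apply: smooth_step1; lra.
- apply: bounded_closed_compact; last by rewrite KE; exact: closed_ball_closed.
  exists (`|u0| + r); split; first exact: num_real.
  move=> M Mr u /= Ku; apply: le_trans (ltW Mr).
  rewrite -[u](subrK u0) addrC (le_trans (ler_normD _ _)) // lerD2l.
  by rewrite distrC.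
- move=> u /= Ku; apply: dO; rewrite -ball_normE /ball_ /= (le_lt_trans Ku) //.
  by rewrite /r ltr_pdivrMr // ltr_pMr // ltr1n.
- move=> u /= /negP; rewrite -ltNge => Ku; apply: smooth_step0.
  suff : 1 <= Q u by lra.
  have /mx_norm_neq0[[i0 i] /= E] : mx_norm (u0 - u) != 0.
    by rewrite gt_eqF //; exact: lt_trans Ku.
  rewrite /Q (bigD1 i) //=; apply: (@le_trans _ _ ((u 0 i - u0 0 i) / r * ((u 0 i - u0 0 i) / r))).
    have : r < `|u0 - u| := Ku; rewrite [`|_|]E !mxE (ord1 i0) => Ki.
    rewrite -expr2 -real_normK ?num_real // exprn_ege1 // normrM normfV (gtr0_norm r0).
    by rewrite ler_pdivlMr // mul1r distrC ltW.
  by rewrite lerDl sumr_ge0 // => j _; rewrite -expr2 sqr_ge0.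
Qed.

End Bump.

(** * Functions and maps in charts *)

Section Atlas.
Variable R : realType.

(** The total spaces of A and of its dual have charts but no topology of their own. These
    conditions, which only mention images of charts, hold for them as well as for M. *)
Record is_atlas n X (AX : set (chart R n X)) : Prop := IsAtlas {
  atlas_covers : forall x, exists2 c, AX c & cdom c x;
  atlas_cancel : forall c, AX c -> forall x, cdom c x -> cpoint c (ccoord c x) = x;
  atlas_image_open : forall c, AX c -> open (ccoord c @` cdom c) }.

Definition smooth_chart_at n X (W : normedModType R) (c : chart R n X) (f : X -> W) x :=
  smooth_at (f \o cpoint c) (ccoord c x).

Lemma smooth_withinP n X (AX : set (chart R n X)) (W : normedModType R) (U : set X)
    (f : X -> W) :
  (forall c, AX c -> open (ccoord c @` (cdom c `&` U))) ->
  smooth_within AX U f <->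
  (forall c x, AX c -> cdom c x -> U x -> smooth_chart_at c f x).
Proof.
move=> oU; split=> [sf c x AXc cx Ux|sf c AXc].
  by apply: (smooth_at_on (oU _ AXc) _ (sf c AXc)); exists x.
by apply/(smooth_onP _ (oU _ AXc)) => _ [x [cx Ux] <-]; exact: sf.
Qed.

Section Functions.
Variables (n : nat) (X : Type) (AX : set (chart R n X)).
Hypothesis aX : is_atlas AX.
Implicit Types (f g : X -> R).

Lemma smooth_funP f : smooth_fun AX f <->
  (forall c x, AX c -> cdom c x -> smooth_chart_at c f x).
Proof.
have oT d : AX d -> open (ccoord d @` (cdom d `&` setT)).
  by move=> AXd; rewrite setIT; exact: (atlas_image_open aX).
apply: (iff_trans (smooth_withinP (W := R) f oT)); split=> sf c x AXc cx.
  exact: sf.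
by move=> _; exact: sf.
Qed.

Lemma smooth_fun_cst (k : R) : smooth_fun AX (cst k).
Proof. by apply/smooth_funP => c x _ _; exact: smooth_at_cst. Qed.

Lemma smooth_funD f g : smooth_fun AX f -> smooth_fun AX g ->
  smooth_fun AX (fun x => f x + g x).
Proof.
move=> /smooth_funP sf /smooth_funP sg; apply/smooth_funP => c x AXc cx.
by apply: smooth_atD; [exact: sf|exact: sg].
Qed.

Lemma smooth_funM f g : smooth_fun AX f -> smooth_fun AX g ->
  smooth_fun AX (fun x => f x * g x).
Proof.
move=> /smooth_funP sf /smooth_funP sg; apply/smooth_funP => c x AXc cx.
by apply: smooth_atM; [exact: sf|exact: sg].
Qed.

Lemma smooth_funZ (k : R) f : smooth_fun AX f -> smooth_fun AX (fun x => k * f x).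
Proof. by move=> sf; apply: smooth_funM => //; exact: smooth_fun_cst. Qed.

Lemma smooth_funN f : smooth_fun AX f -> smooth_fun AX (fun x => - f x).
Proof.
move=> /(smooth_funZ (-1)); congr smooth_fun.
by apply/funext => x; rewrite mulN1r.
Qed.

Lemma smooth_funB f g : smooth_fun AX f -> smooth_fun AX g ->
  smooth_fun AX (fun x => f x - g x).
Proof. by move=> sf sg; apply: smooth_funD => //; exact: smooth_funN. Qed.

Lemma smooth_fun_sum (I : Type) (s : seq I) (f : I -> X -> R) :
  (forall i, smooth_fun AX (f i)) -> smooth_fun AX (fun x => \sum_(i <- s) f i x).
Proof.
move=> sf; apply/smooth_funP => c x AXc cx.
by apply: smooth_at_sum => i; apply: (smooth_funP (f i)).1.
Qed.

Variables (c : chart R n X) (x : X).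
Hypotheses (AXc : AX c) (cx : cdom c x).

Lemma coord_vector_linear_fun (v : 'rV[R]_n) (k : R) f g :
  smooth_fun AX f -> smooth_fun AX g ->
  coord_vector c x v (fun y => k * f y + g y) =
  k * coord_vector c x v f + coord_vector c x v g.
Proof.
move=> /smooth_funP/(_ _ _ AXc cx) df /smooth_funP/(_ _ _ AXc cx) dg.
exact: derive_linear_fun df dg.
Qed.

Lemma coord_vectorD (v : 'rV[R]_n) f g : smooth_fun AX f -> smooth_fun AX g ->
  coord_vector c x v (fun y => f y + g y) = coord_vector c x v f + coord_vector c x v g.
Proof.
move=> sf sg; rewrite -[coord_vector c x v f]mul1r -coord_vector_linear_fun //.
by congr coord_vector; apply/funext => y; rewrite mul1r.
Qed.

Lemma coord_vectorM (v : 'rV[R]_n) f g : smooth_fun AX f -> smooth_fun AX g ->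
  coord_vector c x v (fun y => f y * g y) =
  coord_vector c x v f * g x + f x * coord_vector c x v g.
Proof.
move=> /smooth_funP/(_ _ _ AXc cx) df /smooth_funP/(_ _ _ AXc cx) dg.
by have := derive_mul_fun v df dg; rewrite /= (atlas_cancel aX).
Qed.

Lemma coord_vector_cst (v : 'rV[R]_n) (k : R) : coord_vector c x v (cst k) = 0.
Proof. exact: derive_cst. Qed.

Lemma coord_vectorZ (v : 'rV[R]_n) (k : R) f : smooth_fun AX f ->
  coord_vector c x v (fun y => k * f y) = k * coord_vector c x v f.
Proof.
move=> sf; rewrite (coord_vectorM v (smooth_fun_cst k) sf).
by rewrite coord_vector_cst mul0r add0r.
Qed.

Lemma coord_vectorN (v : 'rV[R]_n) f : smooth_fun AX f ->
  coord_vector c x v (fun y => - f y) = - coord_vector c x v f.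
Proof.
move=> sf; rewrite -mulN1r -coord_vectorZ //.
by congr coord_vector; apply/funext => y; rewrite mulN1r.
Qed.

Lemma coord_vectorB (v : 'rV[R]_n) f g : smooth_fun AX f -> smooth_fun AX g ->
  coord_vector c x v (fun y => f y - g y) = coord_vector c x v f - coord_vector c x v g.
Proof.
move=> sf sg; rewrite coord_vectorD ?coord_vectorN //; exact: smooth_funN.
Qed.

Lemma coord_vector_sum (v : 'rV[R]_n) (I : Type) (s : seq I) (f : I -> X -> R) :
  (forall i, smooth_fun AX (f i)) ->
  coord_vector c x v (fun y => \sum_(i <- s) f i y) = \sum_(i <- s) coord_vector c x v (f i).
Proof.
move=> sf; elim: s => [|i s IH].
  rewrite big_nil -[RHS](coord_vector_cst v 0); congr coord_vector.
  by apply/funext => y; rewrite big_nil.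
rewrite big_cons -IH -coord_vectorD //; last exact: smooth_fun_sum.
by congr coord_vector; apply/funext => y; rewrite big_cons.
Qed.

Lemma coord_vector_row_sum (v : 'rV[R]_n) f : smooth_fun AX f ->
  coord_vector c x v f = \sum_i v 0 i * coord_vector c x (delta_mx 0 i) f.
Proof.
by move=> /smooth_funP/(_ _ _ AXc cx)/(derive_row_sum v).
Qed.

End Functions.

(** The differential vanishes at x, in every chart around x; [stationary_at_chart] reduces this to a
    single chart. *)
Definition stationary_at n X (AX : set (chart R n X)) (x : X) (f : X -> R) : Prop :=
  forall c, AX c -> cdom c x -> forall v, coord_vector c x v f = 0.

Lemma stationary_at_linear n X (AX : set (chart R n X)) x (k : R) (f g : X -> R) :
  is_atlas AX -> smooth_fun AX f -> smooth_fun AX g ->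
  stationary_at AX x f -> stationary_at AX x g ->
  stationary_at AX x (fun y => k * f y + g y).
Proof.
move=> aX sf sg stf stg c AXc cx v.
by rewrite (coord_vector_linear_fun aX) // stf // stg // mulr0 addr0.
Qed.

Lemma stationary_at_cst n X (AX : set (chart R n X)) x (k : R) :
  stationary_at AX x (cst k).
Proof. by move=> c _ _ v; exact: derive_cst. Qed.

Section Maps.
Variables (n m : nat) (X Y : Type) (AX : set (chart R n X)) (AY : set (chart R m Y)).
Hypotheses (aX : is_atlas AX) (aY : is_atlas AY).
Variable F : X -> Y.
Hypothesis sF : smooth_map AX AY F.

Section TwoCharts.
Variables (c : chart R n X) (d : chart R m Y) (x : X).
Hypotheses (AXc : AX c) (AYd : AY d) (cx : cdom c x) (dFx : cdom d (F x)).

Lemma smooth_map_at : smooth_at (ccoord d \o F \o cpoint c) (ccoord c x).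
Proof.
have [oF smF] := sF AXc AYd.
by apply: (smooth_at_on oF _ smF); exists x.
Qed.

Lemma smooth_map_near : \forall u \near ccoord c x,
  [/\ cdom c (cpoint c u), cdom d (F (cpoint c u)) & ccoord c (cpoint c u) = u].
Proof.
have [oF _] := sF AXc AYd.
apply: filterS (open_nbhs_nbhs (conj oF _)); last by exists x.
by move=> _ [y [cy dFy] <-]; rewrite (atlas_cancel aX).
Qed.

Lemma chart_map_comp (W : Type) (g : Y -> W) : \forall u \near ccoord c x,
  (g \o cpoint d) ((ccoord d \o F \o cpoint c) u) = (g \o F \o cpoint c) u.
Proof.
apply: filterS smooth_map_near => u [_ dFu _] /=.
by rewrite (atlas_cancel aY).
Qed.

Lemma smooth_chart_at_comp (g : Y -> R) : smooth_chart_at d g (F x) ->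
  smooth_chart_at c (g \o F) x.
Proof.
move=> sg; apply: (near_eq_smooth_at (chart_map_comp g)).
apply: smooth_at_comp; last exact: smooth_map_at.
by rewrite /= (atlas_cancel aX).
Qed.

Lemma coord_vector_comp (g : Y -> R) v : smooth_chart_at d g (F x) ->
  coord_vector c x v (g \o F) =
  coord_vector d (F x) ('D_v (ccoord d \o F \o cpoint c) (ccoord c x)) g.
Proof.
move=> sg; rewrite /coord_vector -(near_eq_derive _ (chart_map_comp g)).
rewrite derive_comp; [|by rewrite /= (atlas_cancel aX)|exact: smooth_map_at].
by rewrite /= (atlas_cancel aX).
Qed.

End TwoCharts.

Lemma smooth_fun_comp (g : Y -> R) : smooth_fun AY g -> smooth_fun AX (g \o F).
Proof.
move=> sg; apply/(smooth_funP aX) => c x AXc cx.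
have [d AYd dFx] := atlas_covers aY (F x).
by apply: (smooth_chart_at_comp AXc AYd) => //; exact: (smooth_funP aY _).1.
Qed.

Lemma stationary_at_comp (g : Y -> R) x : smooth_fun AY g ->
  stationary_at AY (F x) g -> stationary_at AX x (g \o F).
Proof.
move=> sg stg c AXc cx v; have [d AYd dFx] := atlas_covers aY (F x).
rewrite (coord_vector_comp AXc AYd) ?stg //; exact: (smooth_funP aY _).1.
Qed.

End Maps.

(** The identity read in two charts is the change of coordinates, so the chain rule carries the
    vanishing of the differential from one chart to the other. *)
Lemma stationary_at_chart n X (AX : set (chart R n X)) (c : chart R n X) x (f : X -> R) :
  is_atlas AX -> smooth_map AX AX id -> smooth_fun AX f -> AX c -> cdom c x ->
  (forall v, coord_vector c x v f = 0) -> stationary_at AX x f.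
Proof.
move=> aX sid sf AXc cx f0 d AXd dx v.
rewrite -[f]/(f \o id) (coord_vector_comp aX aX sid AXd AXc) ?f0 //.
exact: (smooth_funP aX _).1.
Qed.

End Atlas.

(** * Bump functions on manifolds *)

Section Manifold.
Variables (R : realType) (n : nat) (M : smoothManifold R n).

Lemma manifold_atlas : is_atlas (atlas M).
Proof.
split; [exact: atlas_cover|exact: chart_cancel|exact: chart_open_image].
Qed.

Section Chart.
Variables (c : chart R n M) (x : M).
Hypotheses (Mc : atlas M c) (cx : cdom c x).

Lemma near_chart (P : M -> Prop) : (\forall y \near x, P y) ->
  \forall u \near ccoord c x, P (cpoint c u).
Proof.
move=> xP; have cc := chart_inv_continuous Mc (ex_intro2 _ _ x cx erefl).
by apply: cc; rewrite (chart_cancel Mc).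
Qed.

Lemma near_point (P : 'rV[R]_n -> Prop) : (\forall u \near ccoord c x, P u) ->
  \forall y \near x, P (ccoord c y).
Proof. by move=> xP; exact: (chart_continuous Mc cx). Qed.

Lemma near_chart_domain : \forall y \near x, cdom c y.
Proof. exact: (open_nbhs_nbhs (conj (chart_open Mc) cx)). Qed.

Lemma near_chart_cancel : \forall u \near ccoord c x,
  cdom c (cpoint c u) /\ ccoord c (cpoint c u) = u.
Proof.
apply: filterS (open_nbhs_nbhs (conj (chart_open_image Mc) _)); last by exists x.
by move=> _ [y cy <-]; rewrite (chart_cancel Mc).
Qed.

Lemma near_eq_smooth_chart_at (W : normedModType R) (f g : M -> W) :
  (\forall y \near x, f y = g y) -> smooth_chart_at c f x -> smooth_chart_at c g x.
Proof. by move=> /near_chart; exact: near_eq_smooth_at. Qed.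

End Chart.

Lemma open_chart_image (c : chart R n M) (U : set M) : atlas M c -> open U ->
  open (ccoord c @` (cdom c `&` U)).
Proof.
move=> Mc oU; rewrite openE => _ [x [cx Ux] <-].
have Ucx := near_chart Mc cx (open_nbhs_nbhs (conj oU Ux)).
have := near_chart_cancel Mc cx; apply: filterS2 Ucx => u Uu [cu uE].
by exists (cpoint c u).
Qed.

Lemma manifold_smooth_id : smooth_map (atlas M) (atlas M) id.
Proof.
move=> c d Mc Md; split; first exact: open_chart_image (chart_open Md).
exact: chart_transition.
Qed.

Lemma smooth_chart_atP (f : M -> R) x c d : atlas M c -> atlas M d ->
  cdom c x -> cdom d x -> smooth_chart_at d f x -> smooth_chart_at c f x.
Proof.
move=> Mc Md cx dx.
exact: (smooth_chart_at_comp manifold_atlas manifold_atlas manifold_smooth_id Mc Md).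
Qed.

Lemma smooth_chart_at_coord x c d : atlas M c -> atlas M d -> cdom c x -> cdom d x ->
  smooth_chart_at c (ccoord d) x.
Proof.
move=> Mc Md cx dx.
exact: (smooth_map_at manifold_smooth_id Mc Md).
Qed.

(** The value 1 is taken on a neighbourhood, so that multiplication by [phi] preserves derivatives
    at x. The closed set inside [U] is what makes extension by zero smooth. *)
Record is_bump (x : M) (U : set M) (phi : M -> R) : Prop := IsBump {
  bump_smooth : smooth_fun (atlas M) phi;
  bump_eq1 : \forall y \near x, phi y = 1;
  bump_support : exists S, [/\ closed S, S `<=` U & forall y, ~ S y -> phi y = 0] }.

(** A bump function on R^n is read in a chart and extended by zero. Its support lies in the image of
    a compact set, which is closed because M is Hausdorff; hence the extension vanishes near every
    point outside the chart domain. *)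
Lemma exists_bump (x : M) (U : set M) : open U -> U x -> exists phi, is_bump x U phi.
Proof.
move=> oU Ux; have [c Mc cx] := atlas_cover x.
have [psi [K [spsi psi1 cK KU psi0]]] :=
  exists_row_bump (open_chart_image Mc oU) (ex_intro2 _ _ x (conj cx Ux) erefl).
pose phi (y : M) : R := if `[< cdom c y >] then psi (ccoord c y) else 0.
have phiE y : cdom c y -> phi y = psi (ccoord c y).
  by move=> cy; rewrite /phi; case: asboolP.
pose S := cpoint c @` K.
have KS u : K u -> exists y, [/\ u = ccoord c y, cdom c y, U y & cpoint c u = y].
  by move=> /KU[y [cy Uy] <-]; exists y; split=> //; rewrite (chart_cancel Mc).
have cS : closed S.
  apply: compact_closed; first exact: mfd_hausdorff.
  apply: continuous_compact cK; apply/continuous_in_subspaceT => u /set_mem /KS[y [-> cy _ _]].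
  by apply: (chart_inv_continuous Mc); exists y.
have phi0 y : ~ S y -> phi y = 0.
  move=> nSy; rewrite /phi; case: asboolP => // cy; apply: psi0 => Ky.
  by apply: nSy; exists (ccoord c y) => //; rewrite (chart_cancel Mc).
exists phi; split.
- apply/(smooth_funP manifold_atlas) => d y Md dy.
  have [cy|ncy] := pselect (cdom c y).
    have E : \forall z \near y, psi (ccoord c z) = phi z.
      by apply: filterS (near_chart_domain Mc cy) => z cz; rewrite phiE.
    apply: (near_eq_smooth_chart_at Md dy E).
    apply: (smooth_chart_atP Md Mc dy cy); rewrite /smooth_chart_at.
    apply: near_eq_smooth_at (spsi _).
    by apply: filterS (near_chart_cancel Mc cy) => u [_ /= ->].
  have nSy : ~ S y by move=> [u /KS[z [_ cz _ E1]] E2]; apply: ncy; rewrite -E2 E1.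
  have E : \forall z \near y, 0 = phi z.
    apply: filterS (open_nbhs_nbhs (conj (closed_openC cS) nSy)) => z.
    by move=> /phi0.
  exact: (near_eq_smooth_chart_at Md dy E (smooth_at_cst _ _)).
- apply: filterS2 (near_chart_domain Mc cx) (near_point Mc cx psi1) => y cy <-.
  exact: phiE.
- by exists S; split=> // y [u /KS[z [_ _ Uz E1]] <-]; rewrite E1.
Qed.

(** Extension by zero: [f] may be arbitrary outside [U], where the product vanishes on the open
    complement of the support. *)
Lemma smooth_fun_bump x U phi (f : M -> R) : is_bump x U phi ->
  (forall c y, atlas M c -> cdom c y -> U y -> smooth_chart_at c f y) ->
  smooth_fun (atlas M) (fun y => phi y * f y).
Proof.
move=> [/(smooth_funP manifold_atlas) sphi _ [S [cS SU phi0]]] sf.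
apply/(smooth_funP manifold_atlas) => c y Mc cy.
have [Sy|nSy] := pselect (S y).
  by apply: smooth_atM; [exact: sphi|exact/sf/SU].
have E : \forall z \near y, 0 = phi z * f z.
  apply: filterS (open_nbhs_nbhs (conj (closed_openC cS) nSy)) => z.
  by move=> /phi0 ->; rewrite mul0r.
exact: (near_eq_smooth_chart_at Mc cy E (smooth_at_cst _ _)).
Qed.

End Manifold.

(** * Vector bundles and their sections *)

Section RowBlocks.
Variable R : realType.
Implicit Types V : normedModType R.

Lemma smooth_at_row_mx V n r (f : V -> 'rV[R]_n) (g : V -> 'rV[R]_r) x :
  smooth_at f x -> smooth_at g x -> smooth_at (fun y => row_mx (f y) (g y)) x.
Proof.
move=> /smooth_at_rowP sf /smooth_at_rowP sg; apply/smooth_at_rowP => i.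
rewrite -(fintype.splitK i); case: (fintype.split i) => j /=.
  by under eq_fun do rewrite row_mxEl; exact: sf.
by under eq_fun do rewrite row_mxEr; exact: sg.
Qed.

Lemma smooth_at_lsubmx V n r (f : V -> 'rV[R]_(n + r)) x :
  smooth_at f x -> smooth_at (fun y => lsubmx (f y)) x.
Proof.
move=> /smooth_at_rowP sf; apply/smooth_at_rowP => i.
by under eq_fun do rewrite mxE; exact: sf.
Qed.

Lemma smooth_at_rsubmx V n r (f : V -> 'rV[R]_(n + r)) x :
  smooth_at f x -> smooth_at (fun y => rsubmx (f y)) x.
Proof.
move=> /smooth_at_rowP sf; apply/smooth_at_rowP => i.
by under eq_fun do rewrite mxE; exact: sf.
Qed.

Lemma open_lsubmx n r (O : set 'rV[R]_n) : open O ->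
  open [set u : 'rV[R]_(n + r) | O (lsubmx u)].
Proof.
move=> oO; apply: (@open_comp _ _ (lsubmx : 'rV[R]_(n + r) -> 'rV[R]_n)) => // u _.
exact: differentiable_continuous (differentiable_lsubmx u).
Qed.

End RowBlocks.

Section VectorBundle.
Variables (R : realType) (n r : nat) (M : smoothManifold R n) (A : vectorBundle M r).

Section Trivialization.
Variables (t : trivialization r (fiber A)) (x : M).
Hypotheses (At : trivs A t) (tx : tdom t x).

Lemma tisoK : cancel (tiso t x) (tiso t x)^-1%VF.
Proof. by apply/lker0_lfunK/lker0P/bij_inj; exact: triv_bijective At _ tx. Qed.

Lemma tisoVK : cancel (tiso t x)^-1%VF (tiso t x).
Proof.
move=> w; have [g _ gK] := triv_bijective At tx.
by rewrite -[w in LHS]gK tisoK gK.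
Qed.

End Trivialization.

Definition bundle_point (x : M) (a : fiber A x) : total_space (fiber A) :=
  existT (fun x => fiber A x) x a.

Lemma total_chart_cancel (c : chart R n M) (t : trivialization r (fiber A))
    (a : total_space (fiber A)) :
  atlas M c -> trivs A t -> cdom (total_chart c t) a ->
  cpoint (total_chart c t) (ccoord (total_chart c t) a) = a.
Proof.
case: a => x a Mc At [/= cx tx].
rewrite row_mxKl row_mxKr (chart_cancel Mc cx).
by rewrite tisoK.
Qed.

(** The image is the product of an open set of R^n with all of R^r, that is, the preimage of an open
    set under [lsubmx]. *)
Lemma total_chart_open (c : chart R n M) (t : trivialization r (fiber A)) (U : set M) :
  atlas M c -> trivs A t -> open U ->
  open (ccoord (total_chart c t) @`
    (cdom (total_chart c t) `&` @bundle_proj R M (fiber A) @^-1` U)).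
Proof.
move=> Mc At oU.
have oO := open_chart_image Mc (openI (triv_open At) oU).
have := open_lsubmx (r := r) oO; congr open; apply/seteqP; split=> [u|_ [a [[ca ta] Ua] <-]] /=.
  move=> [x [cx [tx Ux]] xu]; exists (bundle_point ((tiso t x)^-1%VF (rsubmx u))) => //.
  by rewrite /= tisoVK // xu hsubmxK.
by exists (bundle_proj a) => //; rewrite /= row_mxKl.
Qed.

Lemma bundle_is_atlas : is_atlas (bundle_atlas A).
Proof.
split.
- move=> a; have [c Mc ca] := atlas_cover (bundle_proj a).
  have [t At ta] := trivs_cover A (bundle_proj a).
  by exists (total_chart c t) => //; exists (c, t).
- by move=> _ [[c t] [/= Mc At] <-] a; exact: total_chart_cancel.
- move=> _ [[c t] [/= Mc At] <-].
  by have := total_chart_open Mc At openT; rewrite preimage_setT setIT.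
Qed.

Lemma bundle_proj_smooth : smooth_map (bundle_atlas A) (atlas M) (@bundle_proj R M (fiber A)).
Proof.
move=> _ d [[c t] [/= Mc At] <-] Md.
have oO := total_chart_open Mc At (chart_open Md); split=> //.
apply/smooth_onP => // _ [a [[ca ta] da] <-].
apply: (@smooth_at_comp_row _ _ _ _ (ccoord d \o cpoint c) lsubmx).
  rewrite /= row_mxKl; exact: (smooth_chart_at_coord Mc Md).
exact/smooth_at_lsubmx/smooth_at_id.
Qed.

Lemma bundle_smooth_id : smooth_map (bundle_atlas A) (bundle_atlas A) id.
Proof.
move=> _ _ [[c t] [/= Mc At] <-] [[d s] [/= Md As] <-].
have oO := total_chart_open Mc At (openI (chart_open Md) (triv_open As)); split=> //.
apply/smooth_onP => // _ [a [[ca ta] [da sa]] <-].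
apply: smooth_at_row_mx.
  apply: (@smooth_at_comp_row _ _ _ _ (ccoord d \o cpoint c) lsubmx).
    rewrite /= row_mxKl; exact: (smooth_chart_at_coord Mc Md).
  exact/smooth_at_lsubmx/smooth_at_id.
apply/smooth_at_rowP => i.
(* The axiom on transitions concerns a fixed vector of R^r. Expanding the fiber coordinate in the
   standard basis separates it from the entries [T], which depend on the base point alone. *)
pose T k x : 'rV[R]_r := tiso s x ((tiso t x)^-1%VF (delta_mx 0 k)).
rewrite (_ : (fun u => _) = (fun u : 'rV[R]_(n + r) =>
    \sum_k (rsubmx u) 0 k * T k (cpoint c (lsubmx u)) 0 i)); last first.
  apply/funext => u /=; rewrite [in LHS](row_sum_delta (rsubmx u)) !linear_sum /= summxE.
  by apply: eq_bigr => k _; rewrite !linearZ /= mxE.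
apply: smooth_at_sum => k; apply: smooth_atM.
  by have /smooth_at_rowP := smooth_at_rsubmx (smooth_at_id (ccoord (total_chart c t) a)); exact.
have oI := openI (triv_open At) (triv_open As).
have /smooth_withinP sT := triv_transition At As (delta_mx 0 k).
have {sT} /smooth_at_rowP/(_ i) := sT (fun c Mc => open_chart_image Mc oI) _ _ Mc ca (conj ta sa).
move=> sT; apply: (@smooth_at_comp _ _ _ (fun v => T k (cpoint c v) 0 i) lsubmx).
  by rewrite /= row_mxKl.
exact/smooth_at_lsubmx/smooth_at_id.
Qed.

Lemma smooth_fun_pullback (f : M -> R) : smooth_fun (atlas M) f ->
  smooth_fun (bundle_atlas A) (f \o @bundle_proj R M (fiber A)).
Proof.
exact: (smooth_fun_comp bundle_is_atlas (manifold_atlas M) bundle_proj_smooth).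
Qed.

Lemma smooth_sectionP (s : forall x, fiber A x) :
  smooth_section s <->
  (forall c t x, atlas M c -> trivs A t -> cdom c x -> tdom t x ->
    smooth_chart_at c (fun y => tiso t y (s y)) x).
Proof.
split=> [ss c t x Mc At cx tx|ss].
  have BA : bundle_atlas A (total_chart c t) by exists (c, t).
  have := smooth_map_at ss Mc BA cx (conj cx tx).
  move=> /smooth_at_rsubmx; apply: near_eq_smooth_at; near=> u.
  by rewrite /= row_mxKr.
move=> c _ Mc [[d t] [/= Md At] <-].
have oO := open_chart_image Mc (openI (chart_open Md) (triv_open At)); split=> //.
apply/smooth_onP => // _ [x [cx [dx tx]] <-].
by apply: smooth_at_row_mx; [exact: (smooth_chart_at_coord Mc Md)|exact: ss].
Unshelve. all: by end_near. Qed.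

Lemma smooth_sectionD (s t : forall x, fiber A x) : smooth_section s ->
  smooth_section t -> smooth_section (fun x => s x + t x).
Proof.
move=> /smooth_sectionP ss /smooth_sectionP st; apply/smooth_sectionP => c e x Mc Ae cx ex.
rewrite /smooth_chart_at /comp; under eq_fun do rewrite linearD.
by apply: smooth_atD; [exact: ss|exact: st].
Qed.

Lemma smooth_sectionM (f : M -> R) (s : forall x, fiber A x) :
  smooth_fun (atlas M) f -> smooth_section s -> smooth_section (fun x => f x *: s x).
Proof.
move=> /(smooth_funP (manifold_atlas M)) sf /smooth_sectionP ss; apply/smooth_sectionP => c e x Mc Ae cx ex.
apply/smooth_at_rowP => i; rewrite /smooth_chart_at /comp.
under eq_fun do rewrite linearZ mxE.
apply: smooth_atM; first exact: sf.
by have /smooth_at_rowP := ss _ _ _ Mc Ae cx ex; exact.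
Qed.

Lemma smooth_sectionZ (k : R) (s : forall x, fiber A x) :
  smooth_section s -> smooth_section (fun x => k *: s x).
Proof. by apply: smooth_sectionM; apply: smooth_fun_cst; exact: manifold_atlas. Qed.

Lemma smooth_section0 : smooth_section (fun x => 0 : fiber A x).
Proof.
apply/smooth_sectionP => c e x Mc Ae cx ex; rewrite /smooth_chart_at /comp.
by under eq_fun do rewrite linear0; exact: smooth_at_cst.
Qed.

Lemma smooth_section_sum (I : Type) (l : seq I) (s : I -> forall x, fiber A x) :
  (forall i, smooth_section (s i)) -> smooth_section (fun x => \sum_(i <- l) s i x).
Proof.
move=> ss; apply/smooth_sectionP => c e x Mc Ae cx ex; rewrite /smooth_chart_at /comp.
under eq_fun do rewrite linear_sum.
by apply: smooth_at_sum => i; exact: (smooth_sectionP _).1.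
Qed.

(** Brackets are taken of global sections only, so the local frame is cut off by [phi]. *)
Definition frame_section (t : trivialization r (fiber A)) (phi : M -> R) (k : 'I_r) :
  forall x, fiber A x := fun x => phi x *: (tiso t x)^-1%VF (delta_mx 0 k).

Lemma smooth_frame_section (t : trivialization r (fiber A)) x0 U phi k :
  trivs A t -> U `<=` tdom t -> is_bump x0 U phi -> smooth_section (frame_section t phi k).
Proof.
move=> At Ut [sphi _ [S [cS SU phi0]]]; apply/smooth_sectionP => c e x Mc Ae cx ex.
have [Sx|nSx] := pselect (S x); last first.
  apply: (near_eq_smooth_chart_at Mc cx _ (smooth_at_cst (0 : 'rV[R]_r) (ccoord c x))).
  apply: filterS (open_nbhs_nbhs (conj (closed_openC cS) nSx)) => z.
  by move=> /phi0 z0; rewrite /frame_section z0 scale0r linear0.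
have tx : tdom t x by exact/Ut/SU.
have oI := openI (triv_open At) (triv_open Ae).
have /smooth_withinP sT := triv_transition At Ae (delta_mx 0 k).
have {}sT := sT (fun c Mc => open_chart_image Mc oI) _ _ Mc cx (conj tx ex).
apply/smooth_at_rowP => i; rewrite /frame_section /smooth_chart_at /comp.
under eq_fun do rewrite linearZ mxE.
apply: smooth_atM; first exact: ((smooth_funP (manifold_atlas M) _).1 sphi).
by have /smooth_at_rowP := sT; exact.
Qed.

(** In place of neighbourhoods in the total space, neighbourhoods of the coordinate vector of [a]
    are used; what holds near the base point is carried over to them. *)
Lemma near_total_chart (c : chart R n M) (t : trivialization r (fiber A))
    (a : total_space (fiber A)) (P : M -> Prop) :
  atlas M c -> trivs A t -> cdom (total_chart c t) a ->
  (\forall y \near bundle_proj a, P y) ->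
  \forall u \near ccoord (total_chart c t) a,
    [/\ P (cpoint c (lsubmx u)), cdom c (cpoint c (lsubmx u)),
        tdom t (cpoint c (lsubmx u)), ccoord c (cpoint c (lsubmx u)) = lsubmx u &
        tiso t (bundle_proj (cpoint (total_chart c t) u))
          (projT2 (cpoint (total_chart c t) u)) = rsubmx u].
Proof.
move=> Mc At [ca ta] xP.
have near_l (Q : 'rV[R]_n -> Prop) : (\forall v \near ccoord c (bundle_proj a), Q v) ->
    \forall u \near ccoord (total_chart c t) a, Q (lsubmx u).
  have E : lsubmx (ccoord (total_chart c t) a) = ccoord c (bundle_proj a).
    by rewrite /= row_mxKl.
  move=> xQ; have := differentiable_continuous
    (differentiable_lsubmx (ccoord (total_chart c t) a)).
  by apply; rewrite E.
have n1 := near_l _ (near_chart Mc ca xP).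
have n2 := near_l _ (near_chart_cancel Mc ca).
have n3 := near_l _ (near_chart Mc ca (open_nbhs_nbhs (conj (triv_open At) ta))).
near=> u.
have [cu uE] : cdom c (cpoint c (lsubmx u)) /\ ccoord c (cpoint c (lsubmx u)) = lsubmx u.
  by near: u; exact: n2.
have tu : tdom t (cpoint c (lsubmx u)) by near: u; exact: n3.
split=> //; first by near: u; exact: n1.
exact: tisoVK.
Unshelve. all: by end_near. Qed.

End VectorBundle.

(** * The dual bundle *)

Section DualBundle.
Variables (R : realType) (n r : nat) (M : smoothManifold R n) (A : vectorBundle M r).

Definition pairing (x : M) (alpha : dual_fiber (fiber A) x) (a : fiber A x) : R :=
  (alpha : 'Hom(fiber A x, R^o)) a.

Lemma pairing_linear x (alpha : dual_fiber (fiber A) x) k a b :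
  pairing alpha (k *: a + b) = k * pairing alpha a + pairing alpha b.
Proof. by rewrite /pairing linearP. Qed.

Lemma linfunE (U V : vectType R) (f : U -> V) : linear f -> linfun f =1 f.
Proof.
move=> lf u; pose L := GRing.isLinear.Build R U V *:%R f lf.
pose g : {linear U -> V} := HB.pack f L.
exact: (lfunE g).
Qed.

Lemma dual_trivE (t : trivialization r (fiber A)) x (alpha : dual_fiber (fiber A) x) i :
  tiso (dual_triv t) x alpha 0 i = pairing alpha ((tiso t x)^-1%VF (delta_mx 0 i)).
Proof.
rewrite /dual_triv /= linfunE ?mxE // => k u v.
by apply/rowP => j; rewrite !mxE add_lfunE scale_lfunE.
Qed.

Section Trivialization.
Variables (t : trivialization r (fiber A)) (x : M).
Hypotheses (At : trivs A t) (tx : tdom t x).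

Lemma pairing_triv (alpha : dual_fiber (fiber A) x) a :
  pairing alpha a = \sum_i tiso (dual_triv t) x alpha 0 i * tiso t x a 0 i.
Proof.
rewrite -{1}(tisoK At tx a) (row_sum_delta (tiso t x a)) /pairing !linear_sum.
apply: eq_bigr => i _; rewrite !linearZ /= -row_sum_delta dual_trivE.
exact: mulrC.
Qed.

Lemma dual_triv_bijective : bijective (tiso (dual_triv t) x).
Proof.
pose h (w : 'rV[R]_r) (a : fiber A x) : R^o := \sum_i w 0 i * tiso t x a 0 i.
have hlin w : linear (h w).
  move=> k a b; rewrite /h scaler_sumr -big_split; apply: eq_bigr => i _ /=.
  by rewrite linearP !mxE mulrDr mulrCA.
exists (fun w => linfun (h w)) => [alpha|w].
  apply/lfunP => a; rewrite linfunE //.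
  by rewrite -[RHS]/(pairing alpha a) pairing_triv.
apply/rowP => i; rewrite dual_trivE /pairing linfunE // /h (tisoVK At tx).
rewrite (bigD1 i) //= !mxE !eqxx mulr1 big1 ?addr0 // => j ji.
by rewrite !mxE eqxx (negPf ji) mulr0.
Qed.

End Trivialization.

(** The transition of the dual bundle from t to s is the transpose of the transition of A from s to
    t, so its entries are smooth without any matrix inversion. *)
Lemma dual_triv_transition (t s : trivialization r (dual_fiber (fiber A))) :
  (@dual_triv R r M (fiber A) @` trivs A) t -> (@dual_triv R r M (fiber A) @` trivs A) s ->
  forall w : 'rV[R]_r, smooth_within (atlas M) (tdom t `&` tdom s)
    (fun x => tiso s x ((tiso t x)^-1%VF w)).
Proof.
move=> [{}t At <-] [{}s As <-] w /=.
have oI := openI (triv_open At) (triv_open As).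
have oI' := openI (triv_open As) (triv_open At).
apply/smooth_withinP => [c Mc|c x Mc cx [tx sx]]; first exact: open_chart_image.
apply/smooth_at_rowP => i.
have E : \forall y \near x, \sum_k w 0 k * tiso t y ((tiso s y)^-1%VF (delta_mx 0 i)) 0 k =
    tiso (dual_triv s) y ((tiso (dual_triv t) y)^-1%VF w) 0 i.
  apply: filterS (open_nbhs_nbhs (conj oI (conj tx sx))) => y [ty sy].
  rewrite dual_trivE (pairing_triv At ty); apply: eq_bigr => k _; congr (_ * _).
  have bt := dual_triv_bijective At ty.
  have [g _ gK] := bt.
  have /lker0_lfunK tK : lker (tiso (dual_triv t) y) == 0%VS by apply/lker0P/bij_inj.
  by rewrite -[w in RHS]gK tK gK.
apply: (near_eq_smooth_chart_at Mc cx E).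
have /smooth_withinP sT := triv_transition As At (delta_mx 0 i).
have /smooth_at_rowP := sT (fun c Mc => open_chart_image Mc oI') _ _ Mc cx (conj sx tx).
move=> {}sT; apply: smooth_at_sum => k; apply: smooth_atM; first exact: smooth_at_cst.
exact: sT.
Qed.

(** Kept transparent: its atlas is then convertible to [dual_atlas A], and the results on vector
    bundles apply to the dual as they stand. *)
Definition dual_bundle : vectorBundle M r.
Proof.
apply: (@VectorBundle R n M r (dual_fiber (fiber A)) (@dual_triv R r M (fiber A) @` trivs A)).
- move=> x; have [t At tx] := trivs_cover A x.
  by exists (dual_triv t) => //; exists t.
- by move=> _ [t At <-]; exact: triv_open At.
- by move=> _ [t At <-] x tx; exact: dual_triv_bijective.
- exact: dual_triv_transition.
Defined.

Lemma dual_is_atlas : is_atlas (dual_atlas A).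
Proof. exact: (bundle_is_atlas dual_bundle). Qed.

Lemma dual_smooth_id : smooth_map (dual_atlas A) (dual_atlas A) id.
Proof. exact: (@bundle_smooth_id _ _ _ _ dual_bundle). Qed.

Definition dual_proj : total_space (dual_fiber (fiber A)) -> M :=
  @bundle_proj R M (dual_fiber (fiber A)).

Definition linear_fun (s : forall x, fiber A x) (alpha : total_space (dual_fiber (fiber A))) : R :=
  pairing (projT2 alpha) (s (dual_proj alpha)).

Section DualChart.
Variables (c : chart R n M) (t : trivialization r (fiber A)).
Hypotheses (Mc : atlas M c) (At : trivs A t).
Let D := total_chart c (dual_triv t).

Lemma dual_chart_atlas : dual_atlas A D.
Proof. by exists (c, dual_triv t) => //; split=> //; exists t. Qed.

Variable alpha : total_space (dual_fiber (fiber A)).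
Hypothesis Dalpha : cdom D alpha.
Let x := dual_proj alpha.

Lemma near_dual_chart (P : M -> Prop) : (\forall y \near x, P y) ->
  \forall u \near ccoord D alpha,
    [/\ P (cpoint c (lsubmx u)), cdom c (cpoint c (lsubmx u)),
        tdom t (cpoint c (lsubmx u)), ccoord c (cpoint c (lsubmx u)) = lsubmx u &
        tiso (dual_triv t) (dual_proj (cpoint D u)) (projT2 (cpoint D u)) = rsubmx u].
Proof.
move=> xP; apply: (@near_total_chart _ _ _ _ dual_bundle) => //.
by exists t.
Qed.

Lemma linear_fun_chart (s : forall x, fiber A x) :
  \forall u \near ccoord D alpha,
  \sum_i rsubmx u 0 i * tiso t (cpoint c (lsubmx u)) (s (cpoint c (lsubmx u))) 0 i =
  (linear_fun s \o cpoint D) u.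
Proof.
have /near_dual_chart : \forall y \near x, True by exact: filterE.
apply: filterS => u [_ _ tu _ E].
rewrite /linear_fun /= (pairing_triv At tu); apply: eq_bigr => i _; congr (_ * _).
by rewrite -[in LHS]E.
Qed.

End DualChart.

Lemma smooth_linear_fun (s : forall x, fiber A x) : smooth_section s ->
  smooth_fun (dual_atlas A) (linear_fun s).
Proof.
move=> /smooth_sectionP ss.
apply/(smooth_funP dual_is_atlas) => _ alpha [[c _] [/= Mc [t At <-]] <-] Da.
apply: near_eq_smooth_at (linear_fun_chart Mc At Da s) _.
have sid := smooth_at_id (ccoord (total_chart c (dual_triv t)) alpha).
apply: smooth_at_sum => i; apply: smooth_atM.
  by have /smooth_at_rowP := smooth_at_rsubmx sid; exact.
have [cx tx] := Da.
have /smooth_at_rowP/(_ i) sti := ss _ _ _ Mc At cx tx.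
apply: (@smooth_at_comp _ _ _ (fun v => tiso t (cpoint c v) (s (cpoint c v)) 0 i) lsubmx).
  by rewrite /= row_mxKl.
exact: smooth_at_lsubmx.
Qed.

Lemma smooth_dual_pullback (f : M -> R) : smooth_fun (atlas M) f ->
  smooth_fun (dual_atlas A) (f \o dual_proj).
Proof. exact: (smooth_fun_pullback (A := dual_bundle)). Qed.

Lemma coord_vector_pullback (c : chart R n M) (t : trivialization r (fiber A))
    (alpha : total_space (dual_fiber (fiber A))) v (f : M -> R) :
  atlas M c -> trivs A t -> cdom (total_chart c (dual_triv t)) alpha ->
  smooth_fun (atlas M) f ->
  coord_vector (total_chart c (dual_triv t)) alpha v (f \o dual_proj) =
  coord_vector c (dual_proj alpha) (lsubmx v) f.
Proof.
move=> Mc At Da sf; have AD := dual_chart_atlas Mc At; have [cx tx] := Da.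
have sp : smooth_map (dual_atlas A) (atlas M) dual_proj.
  exact: (@bundle_proj_smooth _ _ _ _ dual_bundle).
rewrite (coord_vector_comp dual_is_atlas (manifold_atlas M) sp AD Mc Da cx); last first.
  exact: ((smooth_funP (manifold_atlas M) f).1 sf).
rewrite (_ : 'D_v _ _ = lsubmx v) //; apply/rowP => i.
rewrite derive_row; last exact: (smooth_map_at sp AD Mc Da cx).
have /(near_dual_chart Mc At Da) : \forall y \near dual_proj alpha, True by exact: filterE.
move=> near_u; rewrite -(@near_eq_derive _ _ _ (fun u : 'rV[R]_(n + r) => u 0 (lshift r i))).
  by rewrite -(derive_row v (lshift r i) (smooth_at_id _)) derive_id mxE.
apply: filterS near_u => u [_ _ _ uE _].
by rewrite /= [ccoord c _]uE mxE.
Qed.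

End DualBundle.

(** * First-order data on the dual bundle *)

Lemma derive_row_coord (R : realType) n (u v : 'rV[R]_n) i :
  'D_v (fun w : 'rV[R]_n => w 0 i : R) u = v 0 i.
Proof. by rewrite -(derive_row v i (smooth_at_id u)) derive_id. Qed.

Section Jets.
Variables (R : realType) (n r : nat) (M : smoothManifold R n) (A : vectorBundle M r).

(* The first-order data (s, f) stands for the fiberwise affine function
   alpha |-> <alpha, s> + f on the dual bundle. *)
Definition jet : Type := ((forall x, fiber A x) * (M -> R))%type.
Implicit Types (j k : jet).

Definition smooth_jet j : Prop := smooth_section j.1 /\ smooth_fun (atlas M) j.2.

Definition jet_fun j (alpha : total_space (dual_fiber (fiber A))) : R :=
  linear_fun j.1 alpha + j.2 (dual_proj alpha).

Definition jet_lin (a : R) j k : jet :=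
  (fun x => a *: j.1 x + k.1 x, fun x => a * j.2 x + k.2 x).

Definition jet_sum (I : finType) (a : I -> R) (j : I -> jet) : jet :=
  (fun x => \sum_i a i *: (j i).1 x, fun x => \sum_i a i * (j i).2 x).

Lemma smooth_jet_lin a j k : smooth_jet j -> smooth_jet k -> smooth_jet (jet_lin a j k).
Proof.
have aM := manifold_atlas M.
move=> [js jf] [ks kf]; split; first by apply: smooth_sectionD => //; exact: smooth_sectionZ.
by apply: smooth_funD => //; exact: smooth_funZ.
Qed.

Lemma smooth_jet_sum (I : finType) (a : I -> R) (j : I -> jet) :
  (forall i, smooth_jet (j i)) -> smooth_jet (jet_sum a j).
Proof.
have aM := manifold_atlas M.
move=> sj; split.
  by apply: smooth_section_sum => i; apply: smooth_sectionZ; have [] := sj i.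
by apply: smooth_fun_sum => // i; apply: smooth_funZ => //; have [] := sj i.
Qed.

Lemma smooth_jet_fun j : smooth_jet j -> smooth_fun (dual_atlas A) (jet_fun j).
Proof.
move=> [js jf]; apply: smooth_funD; first exact: dual_is_atlas.
  exact: smooth_linear_fun.
exact: smooth_dual_pullback.
Qed.

Lemma jet_fun_lin a j k alpha :
  jet_fun (jet_lin a j k) alpha = a * jet_fun j alpha + jet_fun k alpha.
Proof. by rewrite /jet_fun /linear_fun /= pairing_linear mulrDr; ring. Qed.

Lemma jet_fun_sum (I : finType) (a : I -> R) (j : I -> jet) alpha :
  jet_fun (jet_sum a j) alpha = \sum_i a i * jet_fun (j i) alpha.
Proof.
rewrite /jet_fun /linear_fun /pairing /= linear_sum -big_split.
by apply: eq_bigr => i _; rewrite linearZ mulrDr.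
Qed.

(** * Coordinates of the dual bundle as affine functions *)

Section LocalFrame.
Variables (c : chart R n M) (t : trivialization r (fiber A)) (x0 : M) (phi : M -> R).
Hypotheses (Mc : atlas M c) (At : trivs A t).
Hypothesis (bphi : is_bump x0 (cdom c `&` tdom t) phi).

Definition coord_fun (i : 'I_n) : M -> R := fun y => phi y * ccoord c y 0 i.

Lemma smooth_coord_fun i : smooth_fun (atlas M) (coord_fun i).
Proof.
apply: (smooth_fun_bump bphi) => d y Md dy [cy _].
by have /smooth_at_rowP := smooth_chart_at_coord Md Mc dy cy; exact.
Qed.

(** Where [phi] is 1, its function is the coordinate of index [j] on the dual bundle: the first n
    come from functions on M, the last r from the sections of the frame. *)
Definition coord_jet (j : 'I_(n + r)) : jet :=
  match fintype.split j with
  | inl i => (fun x => 0, coord_fun i)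
  | inr k => (frame_section t phi k, cst 0)
  end.

Lemma smooth_coord_jet (j : 'I_(n + r)) : smooth_jet (coord_jet j).
Proof.
rewrite /coord_jet; case: fintype.split => [i|k]; split.
- exact: smooth_section0.
- exact: smooth_coord_fun.
- by apply: (smooth_frame_section _ At _ bphi) => x [].
- by apply: smooth_fun_cst; exact: manifold_atlas.
Qed.

Let D := total_chart c (dual_triv t).

Lemma jet_fun_frame (k : 'I_r) : jet_fun (coord_jet (rshift n k)) = linear_fun (frame_section t phi k).
Proof.
apply/funext => beta; rewrite /jet_fun /coord_jet.
by rewrite -[rshift n k]/(unsplit (inr k)) unsplitK addr0.
Qed.

Section AtPoint.
Variable alpha : total_space (dual_fiber (fiber A)).
Hypothesis Dalpha : cdom D alpha.
Hypothesis phi1 : \forall y \near dual_proj alpha, phi y = 1.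

Lemma coord_jet_near (j : 'I_(n + r)) : \forall u \near ccoord D alpha,
  (u : 'rV[R]_(n + r)) 0 j = (jet_fun (coord_jet j) \o cpoint D) u.
Proof.
apply: filterS (near_dual_chart Mc At Dalpha phi1) => u [pu cu tu uE vE].
rewrite /jet_fun /coord_jet /= -{1}(fintype.splitK j).
case: fintype.split => [i|k] /=.
  rewrite /linear_fun /pairing linear0 add0r /coord_fun pu mul1r uE.
  by rewrite mxE.
rewrite addr0 /linear_fun /pairing /frame_section /= pu scale1r.
rewrite -[RHS]/(pairing _ _) -dual_trivE.
by rewrite -[RHS]/(tiso (dual_triv t) (dual_proj (cpoint D u)) (projT2 (cpoint D u)) 0 k) vE mxE.
Qed.

Lemma coord_vector_coord_jet v (j : 'I_(n + r)) : coord_vector D alpha v (jet_fun (coord_jet j)) = v 0 j.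
Proof.
by rewrite /coord_vector -(near_eq_derive _ (coord_jet_near j)) derive_row_coord.
Qed.

Lemma coord_vector_frame v (k : 'I_r) :
  coord_vector D alpha v (linear_fun (frame_section t phi k)) = v 0 (rshift n k).
Proof. by rewrite -jet_fun_frame coord_vector_coord_jet. Qed.

(** The linear part of the expansion of F at alpha, with the partial derivatives frozen as
    constants. Differentials are matched, values are not. *)
Definition local_jet (F : total_space (dual_fiber (fiber A)) -> R) : jet :=
  jet_sum (fun j : 'I_(n + r) => coord_vector D alpha (delta_mx 0 j) F) coord_jet.

Lemma smooth_local_jet F : smooth_jet (local_jet F).
Proof. exact/smooth_jet_sum/smooth_coord_jet. Qed.

Lemma local_jet_stationary F : smooth_fun (dual_atlas A) F ->
  stationary_at (dual_atlas A) alpha (fun beta => F beta - jet_fun (local_jet F) beta).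
Proof.
move=> sF; have aD := dual_is_atlas A; have AD := dual_chart_atlas Mc At.
have sJ := smooth_jet_fun (smooth_local_jet F).
apply: (stationary_at_chart aD (@dual_smooth_id _ _ _ _ A) _ AD Dalpha).
  exact: smooth_funB.
move=> v; rewrite (coord_vectorB aD AD Dalpha) //.
rewrite (coord_vector_row_sum aD AD Dalpha v sF).
have -> : jet_fun (local_jet F) = (fun beta => \sum_(j : 'I_(n + r))
    coord_vector D alpha (delta_mx 0 j) F * jet_fun (coord_jet j) beta).
  by apply/funext => beta; exact: jet_fun_sum.
rewrite (coord_vector_sum aD AD Dalpha); last first.
  by move=> j; apply: smooth_funZ => //; exact/smooth_jet_fun/smooth_coord_jet.
rewrite -sumrB big1 // => j _.
rewrite (coord_vectorZ aD AD Dalpha); last exact/smooth_jet_fun/smooth_coord_jet.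
by rewrite coord_vector_coord_jet mulrC subrr.
Qed.

End AtPoint.
End LocalFrame.

(** Only differentials at alpha are compared, and [j] is not unique. Its smoothness is required
    because the axioms of the bracket speak of smooth sections. *)
Definition has_jet (F : total_space (dual_fiber (fiber A)) -> R) alpha j : Prop :=
  smooth_jet j /\
  stationary_at (dual_atlas A) alpha (fun beta => F beta - jet_fun j beta).

Lemma exists_local_frame (x : M) :
  exists c t phi, [/\ atlas M c, trivs A t, cdom c x, tdom t x &
    is_bump x (cdom c `&` tdom t) phi].
Proof.
have [c Mc cx] := atlas_cover x; have [t At tx] := trivs_cover A x.
have [phi bphi] := exists_bump (openI (chart_open Mc) (triv_open At)) (conj cx tx).
by exists c, t, phi.
Qed.

Lemma exists_jet F alpha : smooth_fun (dual_atlas A) F -> exists j, has_jet F alpha j.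
Proof.
move=> sF; have [c [t [phi [Mc At cx tx bphi]]]] := exists_local_frame (dual_proj alpha).
have Da : cdom (total_chart c (dual_triv t)) alpha by [].
exists (local_jet c t phi alpha F); split; first exact: (smooth_local_jet Mc At bphi).
exact: (local_jet_stationary Mc At bphi Da (bump_eq1 bphi) sF).
Qed.

Lemma has_jet_fun j alpha : smooth_jet j -> has_jet (jet_fun j) alpha j.
Proof.
move=> sj; split=> //; under eq_fun do rewrite subrr; exact: stationary_at_cst.
Qed.

Lemma has_jet_lin a F G alpha j k : smooth_fun (dual_atlas A) F -> smooth_fun (dual_atlas A) G ->
  has_jet F alpha j -> has_jet G alpha k ->
  has_jet (fun beta => a * F beta + G beta) alpha (jet_lin a j k).
Proof.
move=> sF sG [sj Fj] [sk Gk]; split; first exact: smooth_jet_lin.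
have aD := dual_is_atlas A.
have -> : (fun beta => a * F beta + G beta - jet_fun (jet_lin a j k) beta) =
    (fun beta => a * (F beta - jet_fun j beta) + (G beta - jet_fun k beta)).
  by apply/funext => beta; rewrite jet_fun_lin; ring.
by apply: stationary_at_linear => //; apply: smooth_funB => //; exact: smooth_jet_fun.
Qed.

(** The product rule d(FG) = F(alpha) dG + G(alpha) dF; the zero jet serves to express a scalar
    multiple through [jet_lin]. *)
Lemma has_jetM F G alpha j k : smooth_fun (dual_atlas A) F -> smooth_fun (dual_atlas A) G ->
  has_jet F alpha j -> has_jet G alpha k ->
  has_jet (fun beta => F beta * G beta) alpha
    (jet_lin (F alpha) k (jet_lin (G alpha) j (fun x => 0, cst 0))).
Proof.
have aM := manifold_atlas M.
move=> sF sG [sj Fj] [sk Gk].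
have s0 : smooth_jet (fun x => 0, cst 0).
  by split; [exact: smooth_section0|exact: smooth_fun_cst].
have s1 : smooth_jet (jet_lin (G alpha) j (fun x => 0, cst 0)) by exact: smooth_jet_lin.
split; first exact: smooth_jet_lin.
have aD := dual_is_atlas A; move=> d Ad da v.
have sFG : smooth_fun (dual_atlas A) (fun beta => F beta * G beta) by exact: smooth_funM.
have sjf := smooth_jet_fun sj; have skf := smooth_jet_fun sk.
rewrite (coord_vectorB aD Ad da v sFG); last exact/smooth_jet_fun/smooth_jet_lin.
rewrite (coord_vectorM aD Ad da) //.
have -> : jet_fun (jet_lin (F alpha) k (jet_lin (G alpha) j (fun x => 0, cst 0))) =
    (fun beta => F alpha * jet_fun k beta + G alpha * jet_fun j beta).
  apply/funext => beta; rewrite !jet_fun_lin {3}/jet_fun /linear_fun /pairing linear0 /=.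
  by rewrite !addr0.
rewrite (coord_vector_linear_fun aD Ad da) //; last exact: smooth_funZ.
rewrite (coord_vectorZ aD Ad da) //.
have := Fj _ Ad da v; rewrite (coord_vectorB aD Ad da) // => /subr0_eq ->.
have := Gk _ Ad da v; rewrite (coord_vectorB aD Ad da) // => /subr0_eq ->.
by ring.
Qed.

End Jets.

(** * Lie algebroids *)

Section Algebroid.
Variables (R : realType) (n r : nat) (M : smoothManifold R n) (A : vectorBundle M r).
Variable LA : lieAlgebroid A.
Let aM := manifold_atlas M.
Implicit Types (s t u : forall x, fiber A x) (f g h : M -> R).

Definition anchor_fun s f : M -> R := fun x => anchor LA (s x) f.

(** The smoothness axiom of the anchor presents the derivation as a directional derivative in a
    chart. Hence it kills stationary functions, as [anchor_stationary] records, with no need to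
    factor smooth functions. *)
Lemma anchor_coord (c : chart R n M) x (a : fiber A x) : atlas M c -> cdom c x ->
  exists w, forall f, smooth_fun (atlas M) f -> anchor LA a f = coord_vector c x w f.
Proof.
move=> Mc cx; have [w [_ wE]] := anchor_smooth LA Mc.
by exists (w (bundle_point a)) => f sf; rewrite -(wE (bundle_point a)).
Qed.

Lemma anchor_stationary x (a : fiber A x) f : smooth_fun (atlas M) f ->
  stationary_at (atlas M) x f -> anchor LA a f = 0.
Proof.
move=> sf stf; have [c Mc cx] := atlas_cover x.
have [w wE] := anchor_coord a Mc cx; rewrite wE //; exact: stf.
Qed.

Lemma anchor_fun_linear x (a : fiber A x) k f g :
  smooth_fun (atlas M) f -> smooth_fun (atlas M) g ->
  anchor LA a (fun y => k * f y + g y) = k * anchor LA a f + anchor LA a g.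
Proof. exact: tangent_linear (anchor_tangent LA a) k f g. Qed.

Lemma anchorB x (a : fiber A x) f g :
  smooth_fun (atlas M) f -> smooth_fun (atlas M) g ->
  anchor LA a (fun y => f y - g y) = anchor LA a f - anchor LA a g.
Proof.
move=> sf sg; have -> : (fun y => f y - g y) = (fun y => -1 * g y + f y).
  by apply/funext => y; ring.
by rewrite anchor_fun_linear //; ring.
Qed.

Lemma anchor_sum x (a : fiber A x) (I : finType) (k : I -> R) (f : I -> M -> R) :
  (forall i, smooth_fun (atlas M) (f i)) ->
  anchor LA a (fun y => \sum_i k i * f i y) = \sum_i k i * anchor LA a (f i).
Proof.
move=> sf; have [c Mc cx] := atlas_cover x.
have [w wE] := anchor_coord a Mc cx.
have skf i : smooth_fun (atlas M) (fun y => k i * f i y) by exact: smooth_funZ.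
rewrite wE; last exact: smooth_fun_sum.
rewrite (coord_vector_sum aM Mc cx) //; apply: eq_bigr => i _.
by rewrite (coord_vectorZ aM Mc cx) // wE.
Qed.

Lemma anchor0 x f : smooth_fun (atlas M) f -> anchor LA (0 : fiber A x) f = 0.
Proof.
move=> sf; have := @anchor_linear _ _ _ _ _ LA x 1 0 0 f sf.
by rewrite scaler0 addr0 mul1r => /esym /(canRL (addrK _)); rewrite subrr.
Qed.

(** In a chart the function is the sum of the w^i(s) df/dx^i, where the components w^i of the anchor
    are smooth on the total space and are composed with the section. *)
Lemma smooth_anchor_fun s f : smooth_section s -> smooth_fun (atlas M) f ->
  smooth_fun (atlas M) (anchor_fun s f).
Proof.
move=> ss sf; apply/(smooth_funP aM) => c x Mc cx.
have [w [sw wE]] := anchor_smooth LA Mc.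
have [t At tx] := trivs_cover A x.
have oW d : bundle_atlas A d ->
    open (ccoord d @` (cdom d `&` @bundle_proj R M (fiber A) @^-1` cdom c)).
  by move=> [[e t'] [/= Me At'] <-]; exact: total_chart_open At' (chart_open Mc).
have BA : bundle_atlas A (total_chart c t) by exists (c, t).
have cSx : cdom (total_chart c t) (bundle_point (s x)) by [].
have sw' : smooth_chart_at (total_chart c t) w (bundle_point (s x)).
  exact: ((smooth_withinP w oW).1 sw _ _ BA cSx cx).
have sS := smooth_map_at ss Mc BA cx cSx.
have swS : smooth_chart_at c (fun y => w (bundle_point (s y))) x.
  apply: (near_eq_smooth_at (chart_map_comp aM (bundle_is_atlas A) ss Mc BA cx cSx w)).
  by apply: smooth_at_comp_row sS; rewrite /= (chart_cancel Mc).
have E : \forall u \near ccoord c x, \sum_i w (bundle_point (s (cpoint c u))) 0 i *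
      'D_(delta_mx 0 i) (f \o cpoint c) u = (anchor_fun s f \o cpoint c) u.
  apply: filterS (near_chart_cancel Mc cx) => u [cu uE].
  rewrite /anchor_fun /= (wE (bundle_point (s (cpoint c u))) cu _ sf).
  by rewrite (coord_vector_row_sum aM Mc cu _ sf) /coord_vector uE.
apply: near_eq_smooth_at E _; apply: smooth_at_sum => i; apply: smooth_atM.
  by have /smooth_at_rowP := swS; exact.
by apply: smooth_at_derive; exact: ((smooth_funP aM f).1 sf).
Qed.

Lemma bracket_lin1 s t : (fun y => 1 *: s y + t y) = (fun y => s y + t y).
Proof. by apply: functional_extensionality_dep => y; rewrite scale1r. Qed.

Lemma bracketC s t x : smooth_section s -> smooth_section t ->
  bracket LA s t x = - bracket LA t s x.
Proof.
move=> ss st; have sst := smooth_sectionD ss st.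
have := bracket_alternating LA sst x.
rewrite -bracket_lin1 bracket_linear_l ?bracket_lin1 // -(bracket_lin1 s t).
rewrite !bracket_linear_r // !bracket_alternating // !scale1r add0r addr0.
by move=> /eqP; rewrite addr_eq0 => /eqP.
Qed.

Lemma bracket_leibniz_l f s t x : smooth_fun (atlas M) f ->
  smooth_section s -> smooth_section t ->
  bracket LA (fun y => f y *: s y) t x = f x *: bracket LA s t x - anchor LA (t x) f *: s x.
Proof.
move=> sf ss st; rewrite bracketC //; last exact: smooth_sectionM.
by rewrite bracket_leibniz // opprD -scalerN -bracketC.
Qed.

Lemma bracket0l t x : smooth_section t -> bracket LA (fun y => 0) t x = 0.
Proof.
move=> st; have s0 := @smooth_section0 _ _ _ _ A.
have := bracket_linear_l LA 1 s0 s0 st x.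
rewrite bracket_lin1 scale1r.
rewrite (_ : (fun y => 0 + 0) = (fun y => 0 : fiber A y)).
  by move=> /esym /(canRL (addrK _)); rewrite subrr.
by apply: functional_extensionality_dep => y; rewrite addr0.
Qed.

Lemma bracket_sum_l (I : Type) (l : seq I) (f : I -> M -> R) (s : I -> forall x, fiber A x) t x :
  (forall i, smooth_fun (atlas M) (f i)) -> (forall i, smooth_section (s i)) ->
  smooth_section t ->
  bracket LA (fun y => \sum_(i <- l) f i y *: s i y) t x =
  \sum_(i <- l) (f i x *: bracket LA (s i) t x - anchor LA (t x) (f i) *: s i x).
Proof.
move=> sf ss st; elim: l => [|i l IH].
  rewrite big_nil (_ : (fun y => _) = (fun y => 0 : fiber A y)) ?bracket0l //.
  by apply: functional_extensionality_dep => y; rewrite big_nil.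
rewrite big_cons -IH -bracket_leibniz_l //.
rewrite (_ : (fun y => \sum_(j <- i :: l) _) =
  (fun y => 1 *: (f i y *: s i y) + \sum_(j <- l) f j y *: s j y)).
  rewrite bracket_linear_l ?scale1r //; first exact: smooth_sectionM.
  by apply: smooth_section_sum => j; exact: smooth_sectionM.
by apply: functional_extensionality_dep => y; rewrite big_cons scale1r.
Qed.

(** The nonzero vector [a] excludes rank 0; a frame section and its dual covector then exist. The
    pair serves to read off a coefficient of [u x] in an identity between vectors of the fiber. *)
Lemma fiber_neq0 x (a : fiber A x) : a != 0 ->
  exists u (alpha : dual_fiber (fiber A) x), smooth_section u /\ pairing alpha (u x) = 1.
Proof.
move=> a0; have [c [t [phi [Mc At cx tx bphi]]]] := exists_local_frame A x.
have [k _] : exists k, tiso t x a 0 k != 0.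
  apply/existsP; apply: contraNT a0 => /existsPn a0.
  rewrite -(tisoK At tx a) (_ : tiso t x a = 0) ?linear0 //.
  by apply/rowP => k; rewrite mxE; apply/eqP; have := a0 k; rewrite negbK.
exists (frame_section t phi k), ((tiso (dual_triv t) x)^-1%VF (delta_mx 0 k)); split.
  by apply: (smooth_frame_section _ At _ bphi) => y [].
rewrite (pairing_triv At tx).
rewrite (@tisoVK _ _ _ _ (dual_bundle A) (dual_triv t) x (ex_intro2 _ _ t At erefl) tx).
rewrite /frame_section (nbhs_singleton (bump_eq1 bphi)) scale1r (tisoVK At tx).
rewrite (bigD1 k) //= !mxE !eqxx mulr1 big1 ?addr0 // => i ik.
by rewrite !mxE eqxx (negPf ik) mulr0.
Qed.

(** The Jacobi identity for s, t and f u, minus f times that for s, t and u, leaves the difference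
    of the two sides multiplied by u. Pairing with a covector that takes the value 1 on [u x]
    isolates it. *)
Lemma anchor_bracket s t f x : smooth_section s -> smooth_section t ->
  smooth_fun (atlas M) f ->
  anchor LA (bracket LA s t x) f =
  anchor LA (s x) (anchor_fun t f) - anchor LA (t x) (anchor_fun s f).
Proof.
move=> ss st sf.
have stf := smooth_anchor_fun st sf; have ssf := smooth_anchor_fun ss sf.
have sbst := bracket_smooth LA ss st.
(* If no such section exists, every vector of the fiber is zero and both sides vanish. *)
have all0 (s1 : forall x, fiber A x) g :
    ~ (exists u (alpha : dual_fiber (fiber A) x), smooth_section u /\ pairing alpha (u x) = 1) ->
    smooth_fun (atlas M) g -> anchor LA (s1 x) g = 0.
  move=> nu sg; have [->|s10] := eqVneq (s1 x) 0; first exact: anchor0.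
  by exfalso; apply: nu; exact: fiber_neq0 s10.
have [[u [alpha [su ux1]]]|nu] :=
    pselect (exists u (alpha : dual_fiber (fiber A) x),
      smooth_section u /\ pairing alpha (u x) = 1); last first.
  by rewrite !all0 // subr0.
have sfu := smooth_sectionM sf su.
have := bracket_jacobi LA ss st sfu x.
have sbtu := bracket_smooth LA st su; have sbus := bracket_smooth LA su ss.
have -> : bracket LA t (fun y => f y *: u y) =
    (fun y => 1 *: (f y *: bracket LA t u y) + anchor_fun t f y *: u y).
  by apply: functional_extensionality_dep => y; rewrite scale1r; exact: bracket_leibniz.
have -> : bracket LA (fun y => f y *: u y) s =
    (fun y => 1 *: (f y *: bracket LA u s y) + (- anchor_fun s f y) *: u y).
  apply: functional_extensionality_dep => y; rewrite scale1r scaleNr.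
  exact: bracket_leibniz_l.
have sN := smooth_funN aM ssf.
rewrite !bracket_linear_r //; try exact: smooth_sectionM.
rewrite !bracket_leibniz // bracket_leibniz_l //.
have -> : anchor LA (t x) (fun y => - anchor_fun s f y) = - anchor LA (t x) (anchor_fun s f).
  rewrite (_ : (fun y => _) = (fun y => cst 0 y - anchor_fun s f y)); last first.
    by apply/funext => y; rewrite sub0r.
  have s0 := smooth_fun_cst aM 0.
  rewrite anchorB // (anchor_stationary (t x) s0) ?sub0r //; exact: stationary_at_cst.
have := congr1 (pairing alpha) (bracket_jacobi LA ss st su x).
rewrite (bracketC x su ss) /anchor_fun /pairing !scale1r.
rewrite !(linearD, linearN, linear0) /= => J /(congr1 (pairing alpha)).
rewrite /pairing !(linearD, linearN, linearZ, linear0) /= [_ (u x)]ux1 /GRing.scale /=.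
(* The paired brackets are abstracted to real numbers; once J is multiplied by [f x], the goal is
   linear in the remaining products. *)
move: J; move: (_ (bracket LA s (bracket LA t u) x) : R) => b1.
move: (_ (bracket LA t (bracket LA u s) x) : R) => b2.
move: (_ (bracket LA u (bracket LA s t) x) : R) => b3.
move: (_ (bracket LA t u x) : R) (_ (bracket LA s u x) : R) => b4 b5 /(congr1 ( *%R (f x))).
by rewrite mulr0 => J E; lra.
Qed.

(* The semidirect product of the sections of A with the functions on M. *)
Definition jet_bracket (j k : jet A) : jet A :=
  (bracket LA j.1 k.1, fun x => anchor LA (j.1 x) k.2 - anchor LA (k.1 x) j.2).

Implicit Types (j k l : jet A).

Lemma smooth_jet_bracket j k : smooth_jet j -> smooth_jet k -> smooth_jet (jet_bracket j k).
Proof.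
move=> [js jf] [ks kf]; split; first exact: bracket_smooth.
by apply: smooth_funB => //; exact: smooth_anchor_fun.
Qed.

Lemma jet_bracket_lin_l a j k l alpha : smooth_jet j -> smooth_jet k -> smooth_jet l ->
  jet_fun (jet_bracket (jet_lin a j k) l) alpha =
  a * jet_fun (jet_bracket j l) alpha + jet_fun (jet_bracket k l) alpha.
Proof.
move=> [js jf] [ks kf] [ls lf]; rewrite /jet_fun /linear_fun /= bracket_linear_l //.
by rewrite pairing_linear anchor_linear // anchor_fun_linear //; ring.
Qed.

Lemma jet_bracketC j k alpha : smooth_jet j -> smooth_jet k ->
  jet_fun (jet_bracket j k) alpha = - jet_fun (jet_bracket k j) alpha.
Proof.
move=> [js jf] [ks kf]; rewrite /jet_fun /linear_fun /= bracketC //.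
by rewrite /pairing linearN opprD opprB.
Qed.

Lemma jet_bracket_lin_r a j k l alpha : smooth_jet j -> smooth_jet k -> smooth_jet l ->
  jet_fun (jet_bracket j (jet_lin a k l)) alpha =
  a * jet_fun (jet_bracket j k) alpha + jet_fun (jet_bracket j l) alpha.
Proof.
move=> sj sk sl; rewrite jet_bracketC //; last exact: smooth_jet_lin.
by rewrite jet_bracket_lin_l // (jet_bracketC alpha sj sk) (jet_bracketC alpha sj sl); ring.
Qed.

Lemma jet_bracket_alternating j alpha : smooth_jet j ->
  jet_fun (jet_bracket j j) alpha = 0.
Proof.
move=> [js jf]; rewrite /jet_fun /linear_fun /= bracket_alternating //.
by rewrite /pairing linear0 subrr addr0.
Qed.

(** The section parts cancel by the Jacobi identity of A, the function parts because the anchor is a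
    morphism ([anchor_bracket]). *)
Lemma jet_bracket_jacobi j k l alpha : smooth_jet j -> smooth_jet k -> smooth_jet l ->
  jet_fun (jet_bracket j (jet_bracket k l)) alpha +
  jet_fun (jet_bracket k (jet_bracket l j)) alpha +
  jet_fun (jet_bracket l (jet_bracket j k)) alpha = 0.
Proof.
move=> [js jf] [ks kf] [ls lf]; rewrite /jet_fun /linear_fun /=.
set x := dual_proj alpha.
have E : pairing (projT2 alpha) (bracket LA j.1 (bracket LA k.1 l.1) x) +
    pairing (projT2 alpha) (bracket LA k.1 (bracket LA l.1 j.1) x) +
    pairing (projT2 alpha) (bracket LA l.1 (bracket LA j.1 k.1) x) = 0.
  by rewrite /pairing -!linearD bracket_jacobi // linear0.
have san s f := @smooth_anchor_fun s f.
rewrite !anchorB //; try exact: san.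
rewrite !anchor_bracket // /anchor_fun.
lra.
Qed.

(* If s x = 0, then [s, t] x only depends on the differential at x of the
   components of s in a local frame. *)
Lemma jet_bracket_stationary j k alpha : smooth_jet j -> smooth_jet k ->
  stationary_at (dual_atlas A) alpha (jet_fun j) ->
  jet_fun (jet_bracket j k) alpha = 0.
Proof.
move=> sj sk; have [js jf] := sj; have [ks kf] := sk => stj.
set x := dual_proj alpha.
have [c [t [phi [Mc At cx tx bphi]]]] := exists_local_frame A x.
have Da : cdom (total_chart c (dual_triv t)) alpha by [].
have AD := dual_chart_atlas Mc At; have aD := dual_is_atlas A.
have phi1 := bump_eq1 bphi; have sphi := bump_smooth bphi.
pose e i := frame_section t phi i.
have se i : smooth_section (e i).
  by apply: (smooth_frame_section _ At _ bphi) => y [].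
pose p i := tiso (dual_triv t) x (projT2 alpha) 0 i.
pose f i y : R := phi y * tiso t y (j.1 y) 0 i.
have sf i : smooth_fun (atlas M) (f i).
  apply: (smooth_fun_bump bphi) => d y Md dy [cy ty].
  by have /smooth_at_rowP := (smooth_sectionP _).1 js _ _ _ Md At dy ty; exact.
(* The cutoff enters twice, through [f i] and through [e i]. *)
have jE y : \sum_i f i y *: e i y = (phi y * phi y) *: j.1 y.
  have [S [_ SU phi0]] := bump_support bphi.
  have [/SU[cy ty]|/phi0 py] := pselect (S y); last first.
    by rewrite py mul0r scale0r big1 // => i _; rewrite /f py mul0r scale0r.
  rewrite -[in RHS](tisoK At ty (j.1 y)) [in RHS](row_sum_delta (tiso t y (j.1 y))).
  rewrite linear_sum scaler_sumr; apply: eq_bigr => i _.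
  by rewrite [in RHS]linearZ /= /f /e /frame_section /= !scalerA mulrAC.
have phix : phi x = 1 := nbhs_singleton phi1.
have pe i : pairing (projT2 alpha) (e i x) = p i.
  by rewrite /e /frame_section phix scale1r -dual_trivE.
(* Near x, [h] is the given affine function with the fiber coordinates held at their values p_i at
   alpha. *)
pose h y := 1 * j.2 y + \sum_i p i * f i y.
have sfs : smooth_fun (atlas M) (fun y => \sum_i p i * f i y).
  by apply: smooth_fun_sum => // i; exact: smooth_funZ.
have sle i : smooth_fun (dual_atlas A) (linear_fun (e i)) by exact: smooth_linear_fun.
have sfp i : smooth_fun (dual_atlas A) (f i \o @dual_proj R n r M A).
  exact: smooth_dual_pullback.
have sfe i : smooth_fun (dual_atlas A)
    (fun beta => (f i \o @dual_proj R n r M A) beta * linear_fun (e i) beta).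
  exact: smooth_funM.
have sjp : smooth_fun (dual_atlas A) (j.2 \o @dual_proj R n r M A).
  exact: smooth_dual_pullback.
(* In bundle coordinates the differential at alpha is dh plus the sum of the f_i(x) dp_i. Vertical
   directions then give f_i(x) = 0, horizontal ones give dh = 0. *)
have differential v : coord_vector c x (lsubmx v) h + \sum_i f i x * v 0 (rshift n i) = 0.
  rewrite -[RHS](stj _ AD Da v) /h (coord_vector_linear_fun aM Mc cx) //.
  rewrite (coord_vector_sum aM Mc cx); last by move=> i; exact: smooth_funZ.
  transitivity (coord_vector (total_chart c (dual_triv t)) alpha v
    (fun beta => 1 * (j.2 \o @dual_proj R n r M A) beta +
      \sum_i (f i \o @dual_proj R n r M A) beta * linear_fun (e i) beta)).
    rewrite (coord_vector_linear_fun aD AD Da) //; last exact: smooth_fun_sum.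
    rewrite (coord_vector_pullback _ Mc At Da) // -addrA; congr (_ + _).
    rewrite (coord_vector_sum aD AD Da) // -big_split; apply: eq_bigr => i _.
    rewrite (coord_vectorM aD AD Da) // (coord_vector_pullback _ Mc At Da) //.
    rewrite (coord_vectorZ aM Mc cx) // /comp [in RHS]mulrC; congr (_ * _ + _ * _).
      by rewrite -pe.
    by rewrite (coord_vector_frame Mc At Da phi1).
  apply: near_eq_derive.
  apply: filterS (near_dual_chart Mc At Da phi1) => u [pu _ _ _ _].
  rewrite /jet_fun /= mul1r addrC; congr (_ + _).
  rewrite /linear_fun /pairing; under eq_bigr do rewrite -linearZ.
  by rewrite -linear_sum jE [phi _]pu mulr1 scale1r.
have fx0 i : f i x = 0.
  have := differential (row_mx 0 (delta_mx 0 i)); rewrite row_mxKl.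
  rewrite [X in X + _](_ : _ = 0); last exact: derive0.
  rewrite add0r (bigD1 i) //= row_mxEr mxE !eqxx mulr1 big1 ?addr0 // => i' ii'.
  by rewrite row_mxEr mxE eqxx (negPf ii') mulr0.
have hst : stationary_at (atlas M) x h.
  apply: (stationary_at_chart aM (@manifold_smooth_id _ _ M) _ Mc cx).
    by apply: smooth_funD => //; exact: smooth_funZ.
  move=> w; have := differential (row_mx w 0); rewrite row_mxKl big1 ?addr0 // => i _.
  by rewrite fx0 mul0r.
have h0 : anchor LA (k.1 x) h = 0.
  by apply: anchor_stationary hst; apply: smooth_funD => //; exact: smooth_funZ.
have spp : smooth_fun (atlas M) (fun y => phi y * phi y) by exact: smooth_funM.
have jx0 : j.1 x = 0.
  have := jE x; rewrite phix mul1r scale1r => <-.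
  by rewrite big1 // => i _; rewrite fx0 scale0r.
(* Replacing j.1 by its product with phi^2 does not change the bracket at x: the factor is 1 there,
   and the correction in the Leibniz rule is a multiple of j.1 x = 0. *)
have jk : bracket LA j.1 k.1 x = - \sum_i anchor LA (k.1 x) (f i) *: e i x.
  have := bracket_leibniz_l x spp js ks.
  rewrite phix jx0 scaler0 subr0 mul1r scale1r => <-.
  rewrite (_ : (fun y => _) = (fun y => \sum_i f i y *: e i y)); last first.
    by apply: functional_extensionality_dep => y; rewrite jE.
  rewrite bracket_sum_l // -sumrN; apply: eq_bigr => i _.
  by rewrite fx0 scale0r sub0r.
(* What remains is minus the derivative of [h] along the anchor of [k.1 x]. *)
rewrite /jet_fun /linear_fun /= -/x jk jx0 anchor0 // sub0r.
have := h0; rewrite /h anchor_fun_linear // mul1r anchor_sum //.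
rewrite /pairing linearN linear_sum -opprD addrC => hs.
rewrite (_ : \sum_i _ = \sum_i p i * anchor LA (k.1 x) (f i)) ?hs ?oppr0 //.
by apply: eq_bigr => i _; rewrite linearZ /= -[_ (e i x)]/(pairing _ _) pe [LHS]mulrC.
Qed.


End Algebroid.

(** * The linear Poisson bracket on the dual bundle *)

Section DualBracket.
Variables (R : realType) (n r : nat) (M : smoothManifold R n) (A : vectorBundle M r).
Variable LA : lieAlgebroid A.
Local Notation N := (total_space (dual_fiber (fiber A))).
Local Notation smooth := (smooth_fun (dual_atlas A)).
Let aD := dual_is_atlas A.
Implicit Types (F G H : N -> R) (alpha beta : N).

(** For smooth F and G the set has exactly one element, by [exists_jet] and [has_jet_unique], so the
    default 0 is never taken. *)
Definition dual_bracket F G : N -> R := fun alpha =>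
  xget 0 [set v | exists j k, [/\ has_jet F alpha j, has_jet G alpha k &
    v = jet_fun (jet_bracket LA j k) alpha]].

(** The difference of two jets of F at alpha has a function that is stationary there, so its bracket
    with [k] vanishes at alpha. *)
Lemma has_jet_unique F alpha j j' k : smooth F -> has_jet F alpha j -> has_jet F alpha j' ->
  smooth_jet k ->
  jet_fun (jet_bracket LA j k) alpha = jet_fun (jet_bracket LA j' k) alpha.
Proof.
move=> sF [sj Fj] [sj' Fj'] sk; apply/eqP; rewrite -subr_eq0 addrC -mulN1r.
rewrite -jet_bracket_lin_l // jet_bracket_stationary //; first exact: smooth_jet_lin.
rewrite (_ : jet_fun _ = (fun beta => -1 * (F beta - jet_fun j beta) + (F beta - jet_fun j' beta))).
  by apply: stationary_at_linear => //; apply: smooth_funB => //; exact: smooth_jet_fun.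
by apply/funext => beta; rewrite jet_fun_lin; ring.
Qed.

Lemma dual_bracketE F G alpha j k : smooth F -> smooth G ->
  has_jet F alpha j -> has_jet G alpha k ->
  dual_bracket F G alpha = jet_fun (jet_bracket LA j k) alpha.
Proof.
move=> sF sG Fj Gk; have [sj _] := Fj; have [sk _] := Gk.
apply: xget_unique; first by exists j, k.
move=> _ [j' [k' [Fj' Gk' ->]]]; have [sj' _] := Fj'; have [sk' _] := Gk'.
rewrite (has_jet_unique sF Fj' Fj sk') jet_bracketC // (has_jet_unique sG Gk' Gk sj).
by rewrite -jet_bracketC.
Qed.

Lemma dual_bracket_jet j k : smooth_jet j -> smooth_jet k ->
  dual_bracket (jet_fun j) (jet_fun k) = jet_fun (jet_bracket LA j k).
Proof.
move=> sj sk; apply/funext => alpha.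
by apply: dual_bracketE; [exact: smooth_jet_fun|exact: smooth_jet_fun|exact: has_jet_fun|exact: has_jet_fun].
Qed.

Lemma dual_bracket_alternating F alpha : smooth F -> dual_bracket F F alpha = 0.
Proof.
move=> sF; have [j Fj] := exists_jet alpha sF; have [sj _] := Fj.
by rewrite (dual_bracketE sF sF Fj Fj) jet_bracket_alternating.
Qed.

Lemma dual_bracketC F G : smooth F -> smooth G ->
  dual_bracket F G = (fun alpha => - dual_bracket G F alpha).
Proof.
move=> sF sG; apply/funext => alpha.
have [j Fj] := exists_jet alpha sF; have [k Gk] := exists_jet alpha sG.
have [sj _] := Fj; have [sk _] := Gk.
by rewrite (dual_bracketE sF sG Fj Gk) (dual_bracketE sG sF Gk Fj) jet_bracketC.
Qed.

Lemma dual_bracket_lin_r a F G H : smooth F -> smooth G -> smooth H ->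
  dual_bracket F (fun beta => a * G beta + H beta) =
  (fun alpha => a * dual_bracket F G alpha + dual_bracket F H alpha).
Proof.
move=> sF sG sH; apply/funext => alpha.
have [j Fj] := exists_jet alpha sF; have [k Gk] := exists_jet alpha sG.
have [l Hl] := exists_jet alpha sH.
have [sj _] := Fj; have [sk _] := Gk; have [sl _] := Hl.
have sL : smooth (fun beta => a * G beta + H beta).
  by apply: smooth_funD => //; exact: smooth_funZ.
rewrite (dual_bracketE sF sL Fj (has_jet_lin a sG sH Gk Hl)).
by rewrite (dual_bracketE sF sG Fj Gk) (dual_bracketE sF sH Fj Hl) jet_bracket_lin_r.
Qed.

Lemma dual_bracket_lin_l a F G H : smooth F -> smooth G -> smooth H ->
  dual_bracket (fun beta => a * F beta + G beta) H =
  (fun alpha => a * dual_bracket F H alpha + dual_bracket G H alpha).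
Proof.
move=> sF sG sH; rewrite dual_bracketC //; last by apply: smooth_funD => //; exact: smooth_funZ.
by rewrite dual_bracket_lin_r // (dual_bracketC sF sH) (dual_bracketC sG sH); apply/funext => alpha; ring.
Qed.

Lemma dual_bracket_stationary F G alpha : smooth F -> smooth G ->
  stationary_at (dual_atlas A) alpha F -> dual_bracket F G alpha = 0.
Proof.
move=> sF sG Fst; have [k Gk] := exists_jet alpha sG; have [sk _] := Gk.
have [j Fj] := exists_jet alpha sF; have [sj Fsj] := Fj.
rewrite (dual_bracketE sF sG Fj Gk) jet_bracket_stationary //.
rewrite (_ : jet_fun j = (fun beta => -1 * (F beta - jet_fun j beta) + F beta)).
  by apply: stationary_at_linear => //; apply: smooth_funB => //; exact: smooth_jet_fun.
by apply/funext => beta; ring.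
Qed.

Lemma dual_bracket_leibniz F G H alpha : smooth F -> smooth G -> smooth H ->
  dual_bracket F (fun beta => G beta * H beta) alpha =
  dual_bracket F G alpha * H alpha + G alpha * dual_bracket F H alpha.
Proof.
move=> sF sG sH.
have [j Fj] := exists_jet alpha sF; have [k Gk] := exists_jet alpha sG.
have [l Hl] := exists_jet alpha sH.
have [sj _] := Fj; have [sk _] := Gk; have [sl _] := Hl.
have sGH : smooth (fun beta => G beta * H beta) by exact: smooth_funM.
rewrite (dual_bracketE sF sGH Fj (has_jetM sG sH Gk Hl)).
have s0 : smooth_jet (fun x => 0 : fiber A x, cst 0).
  by split; [exact: smooth_section0|apply: smooth_fun_cst; exact: manifold_atlas].
rewrite jet_bracket_lin_r // ?jet_bracket_lin_r //; last exact: smooth_jet_lin.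
rewrite (jet_bracketC LA alpha sj s0) (jet_bracket_stationary LA s0 sj); last first.
  rewrite (_ : jet_fun _ = cst 0); first exact: stationary_at_cst.
  by apply/funext => beta; rewrite /jet_fun /linear_fun /pairing linear0 addr0.
by rewrite (dual_bracketE sF sG Fj Gk) (dual_bracketE sF sH Fj Hl); ring.
Qed.

Lemma dual_bracket_sum_l (I : Type) (s : seq I) (a : I -> R) (F : I -> N -> R) G alpha :
  (forall i, smooth (F i)) -> smooth G ->
  dual_bracket (fun beta => \sum_(i <- s) a i * F i beta) G alpha =
  \sum_(i <- s) a i * dual_bracket (F i) G alpha.
Proof.
move=> sF sG; elim: s => [|i s IH].
  rewrite big_nil (_ : (fun beta => _) = cst 0).
    by apply: dual_bracket_stationary => //; [exact: smooth_fun_cst|exact: stationary_at_cst].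
  by apply/funext => beta; rewrite big_nil.
rewrite big_cons -IH (_ : (fun beta => _) =
  (fun beta => a i * F i beta + \sum_(j <- s) a j * F j beta)).
  by rewrite dual_bracket_lin_l //; apply: smooth_fun_sum => // j; exact: smooth_funZ.
by apply/funext => beta; rewrite big_cons.
Qed.

Lemma dual_bracket_has_jet F G alpha j : smooth F -> smooth G -> has_jet F alpha j ->
  dual_bracket F G alpha = dual_bracket (jet_fun j) G alpha.
Proof.
move=> sF sG Fj; have [k Gk] := exists_jet alpha sG; have [sj _] := Fj.
rewrite (dual_bracketE sF sG Fj Gk).
by rewrite (dual_bracketE (smooth_jet_fun sj) sG (has_jet_fun alpha sj) Gk).
Qed.

(** * Expansion of the bracket in a local frame *)

Section LocalExpansion.
Variables (c : chart R n M) (t : trivialization r (fiber A)) (alpha : N) (phi : M -> R).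
Hypotheses (Mc : atlas M c) (At : trivs A t).
Let D := total_chart c (dual_triv t).
Hypotheses (Dalpha : cdom D alpha).
Hypothesis bphi : is_bump (dual_proj alpha) (cdom c `&` tdom t) phi.
Let xi i := jet_fun (coord_jet c t phi i).

(** The frame chosen at alpha remains valid at all nearby points, so the expansions below hold on a
    neighbourhood and can be differentiated. *)
Lemma near_dual_frame : \forall u \near ccoord D alpha,
  [/\ cdom D (cpoint D u), \forall y \near dual_proj (cpoint D u), phi y = 1 &
      ccoord D (cpoint D u) = u].
Proof.
have AD := dual_chart_atlas Mc At.
have n1 := smooth_map_near aD (@dual_smooth_id _ _ _ _ A) AD AD Dalpha Dalpha.
have phi2 : \forall y \near dual_proj alpha, \forall z \near y, phi z = 1.
  have [ O [oO Ox Ophi]] := near_open (bump_eq1 bphi).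
  apply: filterS (open_nbhs_nbhs (conj oO Ox)) => y Oy.
  exact: filterS (open_nbhs_nbhs (conj oO Oy)).
apply: filterS2 n1 (near_dual_chart Mc At Dalpha phi2) => u [Du _ uE] [pu _ _ _ _].
by split.
Qed.

Lemma smooth_xi i : smooth (xi i).
Proof. exact/smooth_jet_fun/(smooth_coord_jet Mc At bphi). Qed.

(** The classical formula: {F, G} is the sum of the dF/dxi_i {xi_i, G}. It is stated at points
    [beta] other than alpha while the functions xi_i stay fixed. *)
Lemma dual_bracket_expand F G beta : cdom D beta ->
  (\forall y \near dual_proj beta, phi y = 1) -> smooth F -> smooth G ->
  dual_bracket F G beta =
  \sum_i coord_vector D beta (delta_mx 0 i) F * dual_bracket (xi i) G beta.
Proof.
move=> Db pb sF sG; have Fst := local_jet_stationary Mc At bphi Db pb sF.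
have Fj : has_jet F beta (local_jet c t phi beta F).
  by split=> //; exact: (smooth_local_jet Mc At bphi).
rewrite (dual_bracket_has_jet sF sG Fj) -dual_bracket_sum_l //; last exact: smooth_xi.
rewrite (_ : jet_fun _ = (fun gamma => \sum_i coord_vector D beta (delta_mx 0 i) F * xi i gamma)) //.
by apply/funext => gamma; exact: jet_fun_sum.
Qed.

Lemma dual_bracket_expand_r F G beta : cdom D beta ->
  (\forall y \near dual_proj beta, phi y = 1) -> smooth F -> smooth G ->
  dual_bracket F G beta =
  \sum_i coord_vector D beta (delta_mx 0 i) G * dual_bracket F (xi i) beta.
Proof.
move=> Db pb sF sG; rewrite dual_bracketC // dual_bracket_expand // -sumrN.
by apply: eq_bigr => i _; rewrite (dual_bracketC sF (smooth_xi i)) mulrN.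
Qed.

(** Expanding both arguments gives dF/dxi_i dG/dxi_k {xi_i, xi_k}, where the last factor is the
    function of a smooth jet that does not vary with the point. *)
Lemma smooth_dual_bracket_at F G : smooth F -> smooth G ->
  smooth_chart_at D (dual_bracket F G) alpha.
Proof.
move=> sF sG; have AD := dual_chart_atlas Mc At.
have sx i := smooth_coord_jet Mc At bphi i.
have E : \forall u \near ccoord D alpha, \sum_i \sum_k
    'D_(delta_mx 0 i) (F \o cpoint D) u * ('D_(delta_mx 0 k) (G \o cpoint D) u *
     (jet_fun (jet_bracket LA (coord_jet c t phi i) (coord_jet c t phi k)) \o cpoint D) u) =
    (dual_bracket F G \o cpoint D) u.
  apply: filterS near_dual_frame => u [Du pu uE].
  rewrite /= dual_bracket_expand //; apply: eq_bigr => i _.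
  rewrite dual_bracket_expand_r ?mulr_sumr //; last exact: smooth_xi.
  by apply: eq_bigr => k _; rewrite /coord_vector uE /xi dual_bracket_jet.
apply: near_eq_smooth_at E _; apply: smooth_at_sum => i; apply: smooth_at_sum => k.
have sH H : smooth H -> smooth_at (H \o cpoint D) (ccoord D alpha).
  by move=> sH; exact: ((smooth_funP aD H).1 sH).
apply: smooth_atM; first exact/smooth_at_derive/sH.
apply: smooth_atM; first exact/smooth_at_derive/sH.
by apply/sH/smooth_jet_fun/smooth_jet_bracket.
Qed.

(** Differentiating {H, F} = dF/dxi_k {H, xi_k} at alpha, where dF = 0, only the derivative of
    dF/dxi_k survives. The result is the Hessian of F contracted with the Hamiltonian fields of G
    and H. *)
Lemma dual_bracket_iterated F G H : smooth F -> smooth G -> smooth H ->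
  smooth (dual_bracket H F) ->
  stationary_at (dual_atlas A) alpha F ->
  dual_bracket G (dual_bracket H F) alpha =
  \sum_i \sum_k dual_bracket G (xi i) alpha * dual_bracket H (xi k) alpha *
     'D_(delta_mx 0 i) (fun u => 'D_(delta_mx 0 k) (F \o cpoint D) u) (ccoord D alpha).
Proof.
move=> sF sG sH sHF Fst; have AD := dual_chart_atlas Mc At.
have sat K : smooth K -> smooth_at (K \o cpoint D) (ccoord D alpha).
  by move=> sK; exact: ((smooth_funP aD K).1 sK).
rewrite (dual_bracket_expand_r Dalpha (bump_eq1 bphi) sG sHF).
apply: eq_bigr => i _.
have E : \forall u \near ccoord D alpha,
    \sum_k 'D_(delta_mx 0 k) (F \o cpoint D) u * (dual_bracket H (xi k) \o cpoint D) u =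
    (dual_bracket H F \o cpoint D) u.
  apply: filterS near_dual_frame => u [Du pu uE].
  rewrite /= (dual_bracket_expand_r Du pu sH sF).
  by apply: eq_bigr => k _; rewrite /coord_vector uE.
have sHx k : smooth_at (dual_bracket H (xi k) \o cpoint D) (ccoord D alpha).
  by apply: smooth_dual_bracket_at => //; exact: smooth_xi.
have sDF k : smooth_at (fun u => 'D_(delta_mx 0 k) (F \o cpoint D) u) (ccoord D alpha).
  exact/smooth_at_derive/sat.
rewrite {1}/coord_vector -(near_eq_derive _ E) derive_sum_fun; last first.
  by move=> k; exact: smooth_atM.
rewrite mulr_suml; apply: eq_bigr => k _.
rewrite derive_mul_fun //.
have -> : 'D_(delta_mx 0 k) (F \o cpoint D) (ccoord D alpha) = 0 := Fst _ AD Dalpha _.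
have -> : (dual_bracket H (xi k) \o cpoint D) (ccoord D alpha) = dual_bracket H (xi k) alpha.
  by rewrite /comp (atlas_cancel aD AD Dalpha).
have alg (x y z : R) : (x * y + 0 * z) * (dual_bracket G (xi i) alpha) =
    dual_bracket G (xi i) alpha * y * x by ring.
exact: alg.
Qed.

End LocalExpansion.

Lemma smooth_dual_bracket F G : smooth F -> smooth G -> smooth (dual_bracket F G).
Proof.
move=> sF sG; apply/(smooth_funP aD) => _ alpha [[c _] [/= Mc [t At <-]] <-] Da.
have [ca ta] := Da.
have [phi bphi] := exists_bump (openI (chart_open Mc) (triv_open At)) (conj ca ta).
exact: (smooth_dual_bracket_at Mc At Da bphi).
Qed.

(** * The Jacobi identity on the dual bundle *)

Definition jacobiator F G H alpha : R :=
  dual_bracket F (dual_bracket G H) alpha + dual_bracket G (dual_bracket H F) alpha +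
  dual_bracket H (dual_bracket F G) alpha.

Lemma jacobiatorC F G H alpha : jacobiator F G H alpha = jacobiator G H F alpha.
Proof.
have rot (a b c : R) : a + b + c = b + c + a by ring.
exact: rot.
Qed.

(* The commutator of the derivations {G, -} and {H, -} is of first order. *)
Lemma jacobiator_stationary F G H alpha : smooth F -> smooth G -> smooth H ->
  stationary_at (dual_atlas A) alpha F -> jacobiator F G H alpha = 0.
Proof.
move=> sF sG sH Fst.
have [c [t [phi [Mc At cx tx bphi]]]] := exists_local_frame A (dual_proj alpha).
have Da : cdom (total_chart c (dual_triv t)) alpha by [].
rewrite /jacobiator dual_bracket_stationary ?add0r //; last exact: smooth_dual_bracket.
have -> : dual_bracket F G = (fun beta => -1 * dual_bracket G F beta + cst 0 beta).
  by rewrite dual_bracketC //; apply/funext => beta; rewrite mulN1r addr0.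
have s0 : smooth (cst 0) by exact: smooth_fun_cst.
rewrite dual_bracket_lin_r //; last exact: smooth_dual_bracket.
rewrite (_ : dual_bracket H (cst 0) alpha = 0); last first.
  by rewrite dual_bracketC // dual_bracket_stationary ?oppr0 //; exact: stationary_at_cst.
have it := dual_bracket_iterated Mc At Da bphi sF.
rewrite (it G H) //; last exact: smooth_dual_bracket.
rewrite (it H G) //; last exact: smooth_dual_bracket.
(* The two contractions of the Hessian of F differ by the order of differentiation. *)
rewrite addr0 mulN1r exchange_big /=; apply/eqP; rewrite subr_eq0; apply/eqP.
apply: eq_bigr => k _; apply: eq_bigr => i _.
have sFa := (smooth_funP aD F).1 sF _ _ (dual_chart_atlas Mc At) Da.
by rewrite (derive_schwarz _ _ sFa) [X in X * _ = _]mulrC.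
Qed.

Lemma jacobiator_lin a F1 F2 G H alpha : smooth F1 -> smooth F2 -> smooth G -> smooth H ->
  jacobiator (fun beta => a * F1 beta + F2 beta) G H alpha =
  a * jacobiator F1 G H alpha + jacobiator F2 G H alpha.
Proof.
move=> s1 s2 sG sH; have sB := smooth_dual_bracket.
have e1 := dual_bracket_lin_l a s1 s2 (sB _ _ sG sH).
have e2 := dual_bracket_lin_r a sH s1 s2.
have e2' := dual_bracket_lin_r a sG (sB _ _ sH s1) (sB _ _ sH s2).
have e3 := dual_bracket_lin_l a s1 s2 sG.
have e3' := dual_bracket_lin_r a sH (sB _ _ s1 sG) (sB _ _ s2 sG).
rewrite /jacobiator e1 e2 e2' e3 e3'.
have distr (x1 x2 x3 y1 y2 y3 : R) : a * x1 + y1 + (a * x2 + y2) + (a * x3 + y3) =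
    a * (x1 + x2 + x3) + (y1 + y2 + y3) by ring.
exact: distr.
Qed.

Lemma jacobiator_has_jet F G H alpha j : smooth F -> smooth G -> smooth H ->
  has_jet F alpha j -> jacobiator F G H alpha = jacobiator (jet_fun j) G H alpha.
Proof.
move=> sF sG sH [sj Fst]; have sjf := smooth_jet_fun sj.
have sFj : smooth (fun beta => F beta - jet_fun j beta) by exact: smooth_funB.
rewrite (_ : F = (fun beta => 1 * jet_fun j beta + (F beta - jet_fun j beta))).
  by rewrite jacobiator_lin // mul1r (jacobiator_stationary sFj) ?addr0.
by apply/funext => beta; ring.
Qed.

(** Cyclic rotation brings each argument in turn to the first place, where it may be replaced by its
    jet at alpha; the identity for jets then remains. *)
Lemma dual_bracket_jacobi F G H alpha : smooth F -> smooth G -> smooth H ->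
  jacobiator F G H alpha = 0.
Proof.
move=> sF sG sH.
have [j Fj] := exists_jet alpha sF; have [k Gk] := exists_jet alpha sG.
have [l Hl] := exists_jet alpha sH.
have [sj _] := Fj; have [sk _] := Gk; have [sl _] := Hl.
have sjf := smooth_jet_fun sj; have skf := smooth_jet_fun sk; have slf := smooth_jet_fun sl.
rewrite (jacobiator_has_jet sF sG sH Fj) jacobiatorC (jacobiator_has_jet sG sH sjf Gk).
rewrite jacobiatorC (jacobiator_has_jet sH sjf skf Hl) jacobiatorC.
rewrite /jacobiator !dual_bracket_jet //; try exact: smooth_jet_bracket.
exact: jet_bracket_jacobi.
Qed.

Lemma dual_bracket_poisson : poisson_bracket (dual_atlas A) dual_bracket.
Proof.
split.
- exact: smooth_dual_bracket.
- by move=> k F G H sF sG sH alpha; rewrite dual_bracket_lin_l.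
- by move=> k F G H sF sG sH alpha; rewrite dual_bracket_lin_r.
- by move=> F sF alpha; exact: dual_bracket_alternating.
- by move=> F G H sF sG sH alpha; exact: dual_bracket_jacobi.
- by move=> F G H sF sG sH alpha; exact: dual_bracket_leibniz.
Qed.

End DualBracket.

(** * The Legendre transform and the energy *)

Lemma derive_line (R : realType) (V W : normedModType R) (F : V -> W) (u v : V) :
  'D_1 (fun k : R => F (k *: v + u)) 0 = 'D_v F u.
Proof.
rewrite /derive; congr (lim _).
set g1 := fun h => _; set g2 := fun h => _; suff -> : g1 = g2 by [].
by apply/funext => h; rewrite /g1 /g2 /= scale0r add0r addr0 [h *: 1]mulr1.
Qed.

(** * Transport along a diffeomorphism, Hamiltonian vector fields *)

Section Transport.
Variables (R : realType) (n m : nat) (X Y : Type).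
Variables (AX : set (chart R n X)) (AY : set (chart R m Y)).
Hypotheses (aX : is_atlas AX) (aY : is_atlas AY).

Lemma transport_poisson_bracket (F : X -> Y) (G : Y -> X) br :
  smooth_map AX AY F -> smooth_map AY AX G -> cancel F G -> cancel G F ->
  poisson_bracket AY br ->
  poisson_bracket AX (fun f g => br (f \o G) (g \o G) \o F).
Proof.
move=> sF sG FK GK [br_smooth br_l br_r br_alt br_jac br_leib].
have sfG f : smooth_fun AX f -> smooth_fun AY (f \o G) by exact: smooth_fun_comp.
have comp_id (f : Y -> R) : (f \o F) \o G = f by apply/funext => y; rewrite /= GK.
split.
- move=> f g sf sg; apply: (smooth_fun_comp aX aY sF); by apply: br_smooth; exact: sfG.
- by move=> k f g h sf sg sh x; apply: (br_l k (f \o G) (g \o G) (h \o G)); exact: sfG.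
- by move=> k f g h sf sg sh x; apply: (br_r k (f \o G) (g \o G) (h \o G)); exact: sfG.
- by move=> f sf x; exact/br_alt/sfG.
- by move=> f g h sf sg sh x; rewrite /= !comp_id; apply: br_jac; exact: sfG.
- move=> f g h sf sg sh x.
  by have := br_leib (f \o G) (g \o G) (h \o G) (sfG _ sf) (sfG _ sg) (sfG _ sh) (F x); rewrite /= FK.
Qed.

Lemma hamiltonian_vector_field br (h : X -> R) : poisson_bracket AX br ->
  smooth_fun AX h -> vector_field AX (hamiltonian_field br h).
Proof.
move=> [br_smooth _ br_r _ _ br_leib] sh; split=> [f sf|x]; first exact: br_smooth.
by split=> [k f g sf sg|f g sf sg]; [exact: br_r|exact: br_leib].
Qed.

End Transport.

Section Legendre.
Variables (R : realType) (n r : nat) (M : smoothManifold R n) (A : vectorBundle M r).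
Variable L : total_space (fiber A) -> R.
Hypothesis smoothL : smooth_fun (bundle_atlas A) L.
Let aA := bundle_is_atlas A.
Let aM := manifold_atlas M.

Lemma bundle_chart_atlas (c : chart R n M) (t : trivialization r (fiber A)) :
  atlas M c -> trivs A t -> bundle_atlas A (total_chart c t).
Proof. by exists (c, t). Qed.

Section Chart.
Variables (c : chart R n M) (t : trivialization r (fiber A)).
Hypotheses (Mc : atlas M c) (At : trivs A t).
Let D := total_chart c t.
Let AD := bundle_chart_atlas Mc At.

Definition fiber_partial (k : 'I_r) (u : 'rV[R]_(n + r)) : R :=
  'D_(delta_mx 0 (rshift n k)) (L \o cpoint D) u.

(** In a bundle chart a + k b runs along a straight line with no base component. The formula is
    linear in b, which is why [linfun] in [legendre] returns the fiber derivative itself. *)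
Lemma fiber_derivative_chart (a : total_space (fiber A)) (b : fiber A (bundle_proj a)) :
  cdom D a -> fiber_derivative L (projT2 a) b =
  \sum_k tiso t (bundle_proj a) b 0 k * fiber_partial k (ccoord D a).
Proof.
case: a b => x a /= b [/= cx tx].
have sL := (smooth_funP aA L).1 smoothL D (bundle_point a) AD (conj cx tx).
have E : (fun k : R => L (existT (fun x => fiber A x) x (a + k *: b)) : R^o) =
    (fun k => (L \o cpoint D) (k *: row_mx 0 (tiso t x b) + ccoord D (bundle_point a))).
  apply/funext => k.
  transitivity (L (bundle_point (a + k *: b))) => //.
  rewrite -[in LHS](total_chart_cancel (a := bundle_point (a + k *: b)) Mc At (conj cx tx)).
  congr (L (cpoint D _)); rewrite /= linearD linearZ /= scale_row_mx add_row_mx scaler0 add0r.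
  by rewrite addrC.
rewrite /fiber_derivative derive1E E derive_line.
rewrite (derive_row_sum _ sL) big_split_ord /= big1 ?add0r => [|i _].
  by apply: eq_bigr => k _; rewrite row_mxEr.
by rewrite row_mxEl mxE scale0r.
Qed.

Lemma legendre_pairing (a : total_space (fiber A)) (b : fiber A (bundle_proj a)) :
  cdom D a -> pairing (projT2 (legendre L a)) b =
  \sum_k tiso t (bundle_proj a) b 0 k * fiber_partial k (ccoord D a).
Proof.
move=> Da; rewrite /pairing /= linfunE ?fiber_derivative_chart // => k b1 b2.
rewrite !fiber_derivative_chart // scaler_sumr -big_split; apply: eq_bigr => i _ /=.
by rewrite linearP !mxE mulrDl -mulrA.
Qed.

Lemma energy_chart (a : total_space (fiber A)) : cdom D a ->
  energy L a = \sum_k tiso t (bundle_proj a) (projT2 a) 0 k * fiber_partial k (ccoord D a) - L a.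
Proof. by move=> Da; rewrite /energy /euler_field fiber_derivative_chart. Qed.

Lemma near_bundle_chart (a : total_space (fiber A)) (P : M -> Prop) : cdom D a ->
  (\forall y \near bundle_proj a, P y) ->
  \forall u \near ccoord D a,
    [/\ P (cpoint c (lsubmx u)), cdom D (cpoint D u), ccoord D (cpoint D u) = u,
      ccoord c (cpoint c (lsubmx u)) = lsubmx u &
      tiso t (bundle_proj (cpoint D u)) (projT2 (cpoint D u)) = rsubmx u].
Proof.
move=> Da aP; apply: filterS (near_total_chart Mc At Da aP) => u [Pu cu tu uE vE].
by split=> //; rewrite /= -[RHS]hsubmxK uE -[in RHS]vE.
Qed.

Lemma smooth_fiber_partial (a : total_space (fiber A)) k : cdom D a ->
  smooth_at (fiber_partial k) (ccoord D a).
Proof.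
by move=> Da; apply: smooth_at_derive; exact: ((smooth_funP aA L).1 smoothL).
Qed.

Lemma energy_near (a : total_space (fiber A)) : cdom D a ->
  \forall u \near ccoord D a,
    \sum_k rsubmx u 0 k * fiber_partial k u - L (cpoint D u) = (energy L \o cpoint D) u.
Proof.
move=> Da; have /(near_bundle_chart Da) : \forall y \near bundle_proj a, True by exact: filterE.
apply: filterS => u [_ Du uE _ vE].
by rewrite -[RHS]/(energy L (cpoint D u)) energy_chart // uE vE.
Qed.

End Chart.

Lemma smooth_energy : smooth_fun (bundle_atlas A) (energy L).
Proof.
apply/(smooth_funP aA) => _ a [[c t] [/= Mc At] <-] Da.
apply: near_eq_smooth_at (energy_near Mc At Da) _.
have sid := smooth_at_id (ccoord (total_chart c t) a).
apply: smooth_atB; last first.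
  exact: ((smooth_funP aA L).1 smoothL _ _ (bundle_chart_atlas Mc At) Da).
apply: smooth_at_sum => k; apply: smooth_atM; last exact: smooth_fiber_partial.
by have /smooth_at_rowP := smooth_at_rsubmx sid; exact.
Qed.

(* dE_L = y^k dp_k - (dL/dx^i) dx^i, where p_k = dL/dy^k. *)
Lemma energy_jet (a : total_space (fiber A)) (f : M -> R) :
  smooth_map (bundle_atlas A) (dual_atlas A) (legendre L) ->
  smooth_fun (atlas M) f ->
  exists j : jet A, [/\ smooth_jet j, j.1 (bundle_proj a) = projT2 a &
    stationary_at (bundle_atlas A) a (fun b =>
      energy L b + (f \o @bundle_proj R M (fiber A)) b - jet_fun j (legendre L b))].
Proof.
move=> sLeg sf.
have [c [t [phi [Mc At cx tx bphi]]]] := exists_local_frame A (bundle_proj a).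
pose D := total_chart c t.
have Da : cdom D a by [].
have AD : bundle_atlas A D := bundle_chart_atlas Mc At.
have sL := (smooth_funP aA L).1 smoothL _ _ AD Da.
pose y : 'rV[R]_r := tiso t (bundle_proj a) (projT2 a).
pose q i := 'D_(delta_mx 0 (lshift r i)) (L \o cpoint D) (ccoord D a).
(* Near the base point [s] has the constant components y of a, and [h] carries -dL/dx^i frozen at a,
   together with f. *)
pose s z := \sum_k y 0 k *: frame_section t phi k z.
pose h z := -1 * (\sum_i q i * coord_fun c phi i z) + f z.
have ss : smooth_section s.
  apply: smooth_section_sum => k; apply: smooth_sectionZ.
  by apply: (smooth_frame_section _ At _ bphi) => z [].
have sh : smooth_fun (atlas M) h.
  apply: smooth_funD => //; apply: smooth_funZ => //; apply: smooth_fun_sum => // i.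
  by apply: smooth_funZ => //; exact: (smooth_coord_fun Mc bphi).
have sj : smooth_jet (s, h) by [].
have phi1 := bump_eq1 bphi.
have ts z : tdom t z -> phi z = 1 -> tiso t z (s z) = y.
  move=> tz pz; rewrite /s linear_sum [RHS]row_sum_delta; apply: eq_bigr => k _.
  by rewrite linearZ /= /frame_section pz scale1r (tisoVK At tz).
exists (s, h); split=> //=.
  apply: (can_inj (tisoK At tx)); rewrite ts //; exact: nbhs_singleton phi1.
have sE : smooth_fun (bundle_atlas A) (fun b =>
      energy L b + (f \o @bundle_proj R M (fiber A)) b - jet_fun (s, h) (legendre L b)).
  apply: smooth_funB => //.
    by apply: smooth_funD => //; [exact: smooth_energy|exact: smooth_fun_pullback].
  exact: (smooth_fun_comp aA (dual_is_atlas A) sLeg (smooth_jet_fun sj)).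
apply: (stationary_at_chart aA (@bundle_smooth_id _ _ _ _ A) sE AD Da) => v.
(* The first sum has factors that vanish at a, so its differential there is p_k dy^k; the remaining
   terms contribute (dL/dx^i) dx^i - dL, which is its opposite. The function f cancels exactly. *)
have E : \forall u \near ccoord D a,
    \sum_k (rsubmx u 0 k - y 0 k) * fiber_partial c t k u +
      (\sum_i q i * lsubmx u 0 i - L (cpoint D u)) =
    ((fun b => energy L b + (f \o @bundle_proj R M (fiber A)) b -
      jet_fun (s, h) (legendre L b)) \o cpoint D) u.
  have /(near_bundle_chart Mc At Da) nb := phi1.
  apply: filterS2 nb (energy_near Mc At Da) => u [pu Du uE xE vE] EE.
  have [cu tu] := Du.
  transitivity (energy L (cpoint D u) + f (bundle_proj (cpoint D u)) -
    jet_fun (s, h) (legendre L (cpoint D u))) => //.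
  rewrite -[energy L (cpoint D u)]EE.
  rewrite /jet_fun /linear_fun (legendre_pairing Mc At) // ts // uE.
  have -> : (s, h).2 (dual_proj (legendre L (cpoint D u))) =
      - (\sum_i q i * lsubmx u 0 i) + f (bundle_proj (cpoint D u)).
    rewrite -[LHS]/(h (bundle_proj (cpoint D u))) /h mulN1r; congr (- _ + _); apply: eq_bigr => i _; congr (_ * _).
    by rewrite /coord_fun /= pu mul1r xE.
  under eq_bigr do rewrite mulrBl.
  rewrite sumrB; ring.
rewrite /coord_vector -(near_eq_derive _ E).
set u0 := ccoord D a.
have sid i : smooth_at (fun u : 'rV[R]_(n + r) => u 0 i) u0.
  by have /smooth_at_rowP := smooth_at_id u0; exact.
have lE i : (fun u : 'rV[R]_(n + r) => lsubmx u 0 i) = (fun u => u 0 (lshift r i)).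
  by apply/funext => u; rewrite mxE.
have rE k : (fun u : 'rV[R]_(n + r) => rsubmx u 0 k - y 0 k) = (fun u => u 0 (rshift n k) - y 0 k).
  by apply/funext => u; rewrite mxE.
have sr k : smooth_at (fun u : 'rV[R]_(n + r) => rsubmx u 0 k - y 0 k) u0.
  by rewrite rE; apply: smooth_atB => //; exact: smooth_at_cst.
have sq k : smooth_at (fiber_partial c t k) u0 by exact: smooth_fiber_partial.
have sl i : smooth_at (fun u : 'rV[R]_(n + r) => q i * lsubmx u 0 i) u0.
  by apply: smooth_atM; [exact: smooth_at_cst|rewrite lE].
have srq k : smooth_at (fun u : 'rV[R]_(n + r) => (rsubmx u 0 k - y 0 k) * fiber_partial c t k u) u0.
  exact: smooth_atM.
have sls : smooth_at (fun u : 'rV[R]_(n + r) => \sum_i q i * lsubmx u 0 i) u0.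
  exact: smooth_at_sum.
have sL' : smooth_at (fun u => L (cpoint D u)) u0 := sL.
have dl i : 'D_v (fun u : 'rV[R]_(n + r) => q i * lsubmx u 0 i) u0 = v 0 (lshift r i) * q i.
  rewrite derive_mul_fun ?lE //; last exact: smooth_at_cst.
  by rewrite derive_cst mul0r add0r derive_row_coord mulrC.
have dr k : 'D_v (fun u : 'rV[R]_(n + r) => (rsubmx u 0 k - y 0 k) * fiber_partial c t k u) u0 =
    v 0 (rshift n k) * fiber_partial c t k u0.
  rewrite derive_mul_fun // rE derive_sub_fun //; last exact: smooth_at_cst.
  by rewrite derive_cst derive_row_coord subr0 [rsubmx _]row_mxKr subrr mul0r addr0.
rewrite derive_add_fun; [|exact: smooth_at_sum|exact: smooth_atB].
rewrite derive_sub_fun // !derive_sum_fun //.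
rewrite (eq_bigr _ (fun k _ => dr k)) (eq_bigr _ (fun i _ => dl i)).
rewrite [X in _ + (_ - X)](derive_row_sum v sL) big_split_ord /=.
have cancel_sum (x z : R) : x + (z - (z + x)) = 0 by ring.
exact: cancel_sum.
Qed.

End Legendre.

Theorem theorem3p1 (R : realType) (n r : nat) (M : smoothManifold R n)
    (A : vectorBundle M r) (LA : lieAlgebroid A) (L : total_space (fiber A) -> R)
    (smoothL : smooth_fun (bundle_atlas A) L) (regularL : regular_lagrangian L) :
  exists family : set ((total_space (fiber A) -> R) -> (total_space (fiber A) -> R) ->
                       (total_space (fiber A) -> R)),
    family !=set0 /\
    forall br, family br ->
      poisson_bracket (bundle_atlas A) br /\
      forall f : M -> R, smooth_fun (atlas M) f ->
        semispray LA
          (hamiltonian_field br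
            (fun a => energy L a + (f \o @bundle_proj R M (fiber A)) a)).
Proof.
have aA := bundle_is_atlas A; have aD := dual_is_atlas A.
have [sLeg [G [LegK GK sG]]] := regularL.
pose br F K := dual_bracket LA (F \o G) (K \o G) \o legendre L.
have brP : poisson_bracket (bundle_atlas A) br.
  exact: (transport_poisson_bracket aA aD sLeg sG LegK GK (dual_bracket_poisson LA)).
exists [set br]; split; first by exists br.
move=> _ ->; split=> // f sf.
have sE : smooth_fun (bundle_atlas A)
    (fun a => energy L a + (f \o @bundle_proj R M (fiber A)) a).
  by apply: smooth_funD => //; [exact: smooth_energy|exact: smooth_fun_pullback].
split; first exact: hamiltonian_vector_field brP sE.
move=> a g sg; rewrite /tangent_map /hamiltonian_field /br /=.
have [j [sj ja stj]] := energy_jet smoothL a sLeg sf.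
have sEG := smooth_fun_comp aD aA sG sE.
(* Stationarity at a is carried to the dual bundle by the inverse [G]. *)
have hE : has_jet ((fun a => energy L a + (f \o @bundle_proj R M (fiber A)) a) \o G)
    (legendre L a) j.
  split=> //.
  have sEj : smooth_fun (bundle_atlas A) (fun b => energy L b +
      (f \o @bundle_proj R M (fiber A)) b - jet_fun j (legendre L b)).
    apply: smooth_funB => //.
    exact: (smooth_fun_comp aA aD sLeg (smooth_jet_fun sj)).
  have := stationary_at_comp aD aA sG (x := legendre L a) sEj.
  rewrite LegK => /(_ stj); congr stationary_at.
  by apply/funext => beta; rewrite /= GK.
have s0 : smooth_section (fun x => 0 : fiber A x) by exact: smooth_section0.
have sk : smooth_jet (fun x => 0 : fiber A x, g) by [].
(* The Legendre transform preserves base points by definition; writing [beta] as the image of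
   [G beta] shows that [G] does so too. *)
have gE : (g \o @bundle_proj R M (fiber A)) \o G = jet_fun (fun x => 0 : fiber A x, g).
  apply/funext => beta; rewrite /jet_fun /linear_fun /pairing linear0 add0r /=.
  by rewrite -[in RHS](GK beta).
have hg := has_jet_fun (legendre L a) sk.
rewrite gE (dual_bracketE LA sEG (smooth_jet_fun sk) hE hg).
(* With second jet (0, g), the semidirect bracket reduces to the anchor of s applied to g. *)
have [js jf] := sj; rewrite /jet_fun /linear_fun /= bracketC // bracket0l //.
rewrite /pairing oppr0 linear0 add0r anchor0 // subr0.
exact: (congr1 (fun b => anchor LA b g) ja).
Qed.
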